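(* Let $(s_n)_n$ be a positive sequence with $s_n\to\infty$. For each $n$, let the edges $e$ of the complete graph $K_n$ on $[n]$ carry i.i.d. weights $Y_e^{(K_n)}$ with the law of $E^{s_n}$, where $E$ is exponential with mean $1$. Fix $m\in\mathbb{N}$. Then the topology of the first passage percolation smallest-weight tree from vertex $1$ to its nearest $m$ vertices, together with the (rescaled) weights along its edges, converges in distribution as $n\to\infty$ to the first $m$ steps of invasion percolation on the Poisson-weighted infinite tree. Explicitly: let $i_0=1$ and let $i_1,i_2,\dots,i_{n-1}$ be the other vertices of $K_n$ in increasing order of first passage distance from vertex $1$; for $1\le k\le n-1$ let $i_{p_n(k)}$, $p_n(k)\in\{0,\dots,k-1\}$, be the vertex preceding $i_k$ on the optimal path from $1$ to $i_k$, and let $x_n(k)=n\bigl(Y^{(K_n)}_{\{i_{p_n(k)},i_k\}}\bigr)^{1/s_n}$. Let $v_0=\emptyset_1,v_1,v_2,\dots$ be the vertices of the Poisson-weighted infinite tree in the order in which they are added by invasion percolation started from the root $\emptyset_1$, let $p(k)\in\{0,\dots,k-1\}$ be such that $v_{p(k)}$ is the parent of $v_k$, and let $X_{v_k}$ be the weight of the edge between $v_k$ and its parent. Then $$\bigl(p_n(k),x_n(k)\bigr)_{k=1}^m\ \overset{d}{\longrightarrow}\ \bigl(p(k),X_{v_k}\bigr)_{k=1}^m .$$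
   Context: First passage distance: $d(i,j)=\min_{\pi:i\to j}\sum_{e\in\pi}Y_e^{(K_n)}$ over paths $\pi$ in $K_n$ from $i$ to $j$; almost surely the minimizing (optimal) path $\pi_{i,j}$ is unique and the distances from vertex 1 are distinct. The smallest-weight tree is the union of the optimal paths from vertex $1$. Poisson-weighted infinite tree (PWIT): the infinite rooted tree $\mathcal{T}^{(1)}$ with root $\emptyset_1$ in which each vertex $v$ has children $v1,v2,v3,\dots$; the weight $X_{vk}$ of the edge between $v$ and its $k$-th child is such that, for each $v$, $(X_{v1},X_{v2},\dots)$ are the ordered points of a rate-1 Poisson point process on $(0,\infty)$, independently over $v$. Invasion percolation (IP) on the PWIT: $\mathrm{IP}^{(1)}(0)=\{\emptyset_1\}$, and $\mathrm{IP}^{(1)}(k)$ is obtained from $\mathrm{IP}^{(1)}(k-1)$ by adding the vertex $v\notin \mathrm{IP}^{(1)}(k-1)$ whose parent lies in $\mathrm{IP}^{(1)}(k-1)$ and which has minimal edge weight $X_v$ among all such vertices. *)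

(* Defs.v *)
From HB Require Import structures.
From mathcomp Require Import all_boot all_order all_algebra.
From mathcomp Require Import all_classical all_reals all_analysis measurable_realfun.

Set Implicit Arguments.
Unset Strict Implicit.
Unset Printing Implicit Defensive.

Import Order.TTheory GRing.Theory Num.Theory.
Import numFieldNormedType.Exports.

Local Open Scope classical_set_scope.
Local Open Scope ring_scope.

(** * Independence and convergence in distribution *)

Definition generated_by d (T : measurableType d) d' (U : measurableType d')
    (I : Type) (X : I -> T -> U) : set_system T :=
  <<s \bigcup_i preimage_set_system setT (X i) measurable >>.

Definition mutually_independent d (T : measurableType d) (R : realType)
    (P : probability T R) (I : choiceType) (D : set I)
    (F : I -> set_system T) : Prop :=
  forall (r : seq I) (A : I -> set T), uniq r ->
    (forall i, i \in r -> D i /\ F i (A i)) ->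
  P (\bigcap_(i in [set` r]) A i) = (\prod_(i <- r) P (A i))%E.

Definition borel_fun d (T : measurableType d) (E : topologicalType)
    (X : T -> E) : Prop :=
  forall U : set E, open U -> measurable (X @^-1` U).

(* The X_n may live on different probability spaces. *)
Definition cvg_in_distribution (R : realType) (E : topologicalType)
    (d : nat -> measure_display) (T : forall n, measurableType (d n))
    (P : forall n, probability (T n) R) (X : forall n, T n -> E)
    (d' : measure_display) (T' : measurableType d') (P' : probability T' R)
    (X' : T' -> E) : Prop :=
  [/\ forall n, borel_fun (X n),
      borel_fun X' &
      forall f : E -> R, continuous f -> (exists M, forall x, `|f x| <= M) ->
        ('E_(P n)[f \o X n])%E @[n --> \oo] --> ('E_P'[f \o X'])%E].

(** * First passage percolation on the complete graph *)

(* The law of E ^ s, E exponential with mean 1. *)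
Definition has_exp_power_law d (T : measurableType d) (R : realType)
    (P : probability T R) (s : R) (Y : {RV P >-> R}) : Prop :=
  forall A : set R, measurable A ->
    distribution P Y A = exponential_prob 1 ((fun x => x `^ s) @^-1` A).

(* K_(N+1) has vertex set 'I_N.+1, the distinguished vertex "1" being ord0.
   Edges are the two-element subsets; a weight function y is defined on all
   subsets, but its values on the other subsets play no role. *)
Section FirstPassagePercolation.
Variables (R : realType) (N : nat).
Implicit Types (y : {set 'I_N.+1} -> R) (i j : 'I_N.+1).

Definition is_edge (e : {set 'I_N.+1}) : bool := #|e| == 2.

(* p lists the vertices visited after the starting point i; a self-avoiding
   path of K_(N+1) has at most N edges. *)
Definition is_path i j (p : {bseq N of 'I_N.+1}) : bool :=
  uniq (i :: p) && (last i p == j).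

Definition path_weight y i (p : seq 'I_N.+1) : R :=
  \sum_(e <- pairmap (fun a b => [set a; b]%SET) i p) y e.

Definition direct_path i j : {bseq N of 'I_N.+1} :=
  insub_bseq N (if i == j then [::] else [:: j]).

Definition optimal_path y i j : {bseq N of 'I_N.+1} :=
  [arg min_(p < direct_path i j | is_path i j p) path_weight y i p]%O.

Definition fpp_dist y i j : R := path_weight y i (optimal_path y i j).

(* [:: i_0; i_1; ...; i_N] *)
Definition fpp_order y : seq 'I_N.+1 :=
  ord0 :: sort (fun a b => fpp_dist y ord0 a <= fpp_dist y ord0 b)
               [seq a <- enum 'I_N.+1 | a != ord0].

Definition fpp_vertex y (k : nat) : 'I_N.+1 := nth ord0 (fpp_order y) k.

(* The optimal path visits ord0 :: p and ends at position size p. *)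
Definition fpp_predecessor y j : 'I_N.+1 :=
  let p := optimal_path y ord0 j in nth ord0 (ord0 :: p) (size p).-1.

(* For k > N the values of fpp_parent and fpp_weight are irrelevant. *)
Definition fpp_parent y (k : nat) : nat :=
  index (fpp_predecessor y (fpp_vertex y k)) (fpp_order y).

Definition fpp_weight (s : R) y (k : nat) : R :=
  N.+1%:R *
  y [set fpp_vertex y (fpp_parent y k); fpp_vertex y k]%SET `^ s^-1.

Definition fpp_tree (s : R) y (m : nat) : 'rV[(nat * R)%type]_m :=
  \row_(k < m) (fpp_parent y k.+1, fpp_weight s y k.+1).

End FirstPassagePercolation.

(** * The Poisson-weighted infinite tree *)

(* X 0, X 1, ... are the points, in increasing order, of a rate-1 Poisson point
   process on (0, oo); the number of points in A is the cardinality of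
   [set k | A (X k w)].  The second argument of poisson_prob is a dummy. *)
Definition ordered_poisson_points d (T : measurableType d) (R : realType)
    (P : probability T R) (X : nat -> {RV P >-> R}) : Prop :=
  let npts (A : set R) (w : T) : \bar R := counting [set k | A (X k w)] in
  [/\ \forall w \ae P, forall k, 0 < X k w /\ X k w <= X k.+1 w,
      forall A : set R, measurable A -> A `<=` `]0, +oo[ ->
        (lebesgue_measure A < +oo)%E ->
        forall j : nat, P [set w | npts A w = j%:R%:E] =
          poisson_prob (fine (lebesgue_measure A)) 0%N [set j],
      forall A : set R, measurable A -> A `<=` `]0, +oo[ ->
        lebesgue_measure A = +oo%E ->
        P [set w | npts A w = +oo%E] = 1%E &
      forall A : nat -> set R,
        (forall i, measurable (A i) /\ A i `<=` `]0, +oo[) ->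
        trivIset setT A ->
        mutually_independent P setT
          (fun i => generated_by (fun _ : unit => npts (A i)))].

(* Vertices are words over nat, the root being the empty word; child number
   k + 1 of v is rcons v k.  Edges are indexed by their lower endpoint, so that
   X [::] is unused. *)
Definition vertex := seq nat.

Definition parent (v : vertex) : vertex := take (size v).-1 v.

Definition is_PWIT d (T : measurableType d) (R : realType)
    (P : probability T R) (X : vertex -> {RV P >-> R}) : Prop :=
  (forall v, ordered_poisson_points (fun k => X (rcons v k))) /\
  mutually_independent P setT
    (fun v => generated_by (fun k : nat => X (rcons v k) : T -> R)).

(** * Invasion percolation *)

Section InvasionPercolation.
Variable R : realType.
Implicit Types (x : vertex -> R) (S : seq vertex).

Definition on_boundary S (v : vertex) : bool :=
  [&& v != [::], v \notin S & parent v \in S].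

Definition is_next x S (v : vertex) : Prop :=
  on_boundary S v /\ forall u, on_boundary S u -> x v <= x u.

(* The minimiser is almost surely unique; ties are broken by the numbering of
   vertices (an explicit rule, so that the choice is measurable in x), and the
   root is returned if there is no minimiser. *)
Definition next_vertex x S : vertex :=
  match pselect (exists c : nat,
    `[< exists2 v : vertex, pickle v = c & is_next x S v >]) with
  | left h => odflt [::] (unpickle (ex_minn h))
  | right _ => [::]
  end.

(* IP x k = [:: v_0; v_1; ...; v_k] *)
Fixpoint IP x (k : nat) : seq vertex :=
  if k is k'.+1 then rcons (IP x k') (next_vertex x (IP x k'))
  else [:: [::]].

Definition ip_vertex x (k : nat) : vertex := last [::] (IP x k).

Definition ip_parent x (k : nat) : nat := index (parent (ip_vertex x k)) (IP x k).

Definition ip_tree x (m : nat) : 'rV[(nat * R)%type]_m :=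
  \row_(k < m) (ip_parent x k.+1, x (ip_vertex x k.+1)).

End InvasionPercolation.

(* Main.v *)
(* Let E_e be the 1/s_n-th power of the weight of e: an exponential variable.
   Cut (0, oo) into cells ]h a, h (a + 1)], and fix parents p and cells a_k of
   the m edges, any two cells being non-adjacent. Write A_j for the largest a_k
   used after the arrival of vertex j. The first m steps of invasion percolation
   follow (p, a) only if each vertex j has a child in each prescribed cell and no
   other child below A_j; these are independent events, so the probability is at
   most (h e^h)^m exp(- h sum_j A_j). Conversely, on K_n it is enough that, for
   distinct vertices i_0 = 1, i_1, ..., i_m, the tree edges have n E_e in the
   prescribed cells and every other edge at i_j, j < m, has n E_e > h (A_j + 2):
   because a sum of m terms c^s is at most (c + 1)^s once s is large, sums of
   weights then compare like their largest terms, and the optimal paths follow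
   the tree. These events are disjoint over (i_1, ..., i_m), and independence
   gives a lower bound equivalent to h^m exp(- h sum_j (A_j + 2)). The two
   bounds have a ratio close to 1 when h is small, so that the law of the
   first passage tree asymptotically gives to every finite union of boxes, hence
   to every open set, at least the mass given by invasion percolation; this
   one-sided comparison already implies convergence in distribution. *)
Require Import Defs.
From HB Require Import structures.
From mathcomp Require Import all_boot all_order all_algebra.
From mathcomp Require Import all_classical all_reals all_analysis measurable_realfun.
From mathcomp Require Import finmap zify ring lra.

Set Implicit Arguments.
Unset Strict Implicit.
Unset Printing Implicit Defensive.

Import Order.TTheory GRing.Theory Num.Theory.
Import numFieldNormedType.Exports.

Local Open Scope classical_set_scope.
Local Open Scope ring_scope.

(** * Convergence in distribution from lower bounds on open sets *)

Lemma limn_einf_supE (R : realType) (u : nat -> \bar R) :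
  limn_einf u = ereal_sup (range (einfs u)).
Proof. by rewrite limn_einf_lim; apply/cvg_lim => //; exact: cvg_einfs_sup. Qed.

Lemma le_limn_einf_near (R : realType) (u : nat -> \bar R) (b : \bar R) :
  (forall e : R, 0 < e -> \forall n \near \oo, (b <= u n + e%:E)%E) ->
  (b <= limn_einf u)%E.
Proof.
move=> bu; apply/lee_addgt0Pr => e e0.
have [n0 _ n0P] := bu _ e0.
rewrite -leeBlDr// limn_einf_supE; apply: ereal_sup_ge.
exists (einfs u n0) => //; apply: le_ereal_inf_tmp => _ [k /= n0k <-].
by have := n0P _ n0k; rewrite -leeBlDr.
Qed.

Lemma near_le_limn_einf (R : realType) (u : nat -> \bar R) (b e : R) :
  0 < e -> (b%:E <= limn_einf u)%E ->
  \forall n \near \oo, ((b - e)%:E <= u n)%E.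
Proof.
rewrite limn_einf_supE => e0 bu.
have /ereal_sup_gt[_ [n _ <-] nP] :
    ((b - e)%:E < ereal_sup (range (einfs u)))%E.
  by apply: lt_le_trans bu; rewrite lte_fin ltrBlDr ltrDl.
exists n => // k /= nk; apply: (le_trans (ltW nP)).
by apply: ereal_inf_lbound; exists k.
Qed.

Lemma borel_fun_continuous_comp d (T : measurableType d) (R : realType)
    (E : topologicalType) (X : T -> E) (g : E -> R) :
  borel_fun X -> continuous g -> measurable_fun setT (g \o X).
Proof.
move=> mX cg; apply: (measurability _ (RGenOInfty.measurableE R)).
move=> _ [_ [x ->] <-]; rewrite setTI.
rewrite [X in measurable X](_ : _ = X @^-1` (g @^-1` `]x, +oo[)) //.
by apply: mX; apply: open_comp => //; exact: interval_open.
Qed.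

Section portmanteau.
Context (R : realType) (E : topologicalType) (d : nat -> measure_display)
  (T : forall n, measurableType (d n)) (P : forall n, probability (T n) R)
  (X : forall n, T n -> E) (d' : measure_display) (T' : measurableType d')
  (P' : probability T' R) (X' : T' -> E).
Hypotheses (mX : forall n, borel_fun (@X n)) (mX' : borel_fun X').
Hypothesis open_lower : forall (U : set E) (e : R), open U -> 0 < e ->
  \forall n \near \oo, (P' (X' @^-1` U) <= P n (@X n @^-1` U) + e%:E)%E.

(** Layer-cake formula: both expectations are integrals over r >= 0 of the probability that g
    exceeds r. The sets where g > r are open, so [open_lower] compares these probabilities for each
    r, and Fatou's lemma takes the liminf out of the integral. *)
Let expectation_liminf (g : E -> R) : continuous g -> (forall x, 0 <= g x) ->
  ('E_P'[g \o X'] <= limn_einf (fun n => 'E_(P n)[g \o @X n]))%E.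
Proof.
move=> cg g0.
have mg n := borel_fun_continuous_comp (mX n) cg.
have mg' := borel_fun_continuous_comp mX' cg.
pose G n : {RV P n >-> R} := mfun_Sub (mem_set (mg n)).
pose G' : {RV P' >-> R} := mfun_Sub (mem_set mg').
have EG' := @ge0_expectation_ccdf _ _ _ P' G' (fun w => g0 (X' w)).
have EG n := @ge0_expectation_ccdf _ _ _ (P n) (G n) (fun w => g0 (X w)).
rewrite (_ : (g \o X') = G')// EG'.
rewrite (_ : (fun n => _) = fun n =>
  (\int[lebesgue_measure]_(r in `[0%R, +oo[) ccdf (G n) r)%E); last first.
  by apply/funext => n; rewrite -EG.
apply: (@le_trans _ _ (\int[lebesgue_measure]_(r in `[0%R, +oo[)
    limn_einf (fun n => ccdf (G n) r))%E); last first.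
  apply: fatou => // n.
  by apply: measurable_funTS; exact: ccdf_measurable.
apply: ge0_le_integral => //.
- by apply: measurable_funTS; exact: ccdf_measurable.
- apply: measurableT_comp => //; apply: measurable_fun_limn_esup => n.
  apply: measurableT_comp => //.
  by apply: measurable_funTS; exact: ccdf_measurable.
- move=> r _; apply: le_limn_einf_near => e e0.
  have oU : open (g @^-1` `]r, +oo[) by apply: open_comp => //; exact: interval_open.
  exact: open_lower oU e0.
Unshelve. all: by end_near. Qed.

(** If |f| <= M, both M + f and M - f are nonnegative; the one-sided bound on the first controls the
    liminf of the expectations of f, that on the second their limsup. *)
Lemma portmanteau_open : cvg_in_distribution P X P' X'.
Proof.
split => // f cf [] /= M fM.
have lfun dd (S : measurableType dd) (Q : probability S R) (Z : S -> E) :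
    borel_fun Z -> (f \o Z) \in Lfun Q 1.
  move=> mZ; apply/Lfun1_integrable.
  apply: measurable_bounded_integrable => //.
  - by apply: (le_lt_trans (@probability_le1 _ _ _ Q _ _)); rewrite ?ltry.
  - exact: borel_fun_continuous_comp mZ cf.
  - exists M; split; first by rewrite num_real.
    by move=> x Mx w _ /=; exact: le_trans (fM _) (ltW Mx).
have EM dd (S : measurableType dd) (Q : probability S R) (Z : S -> E) :
    borel_fun Z ->
    ('E_Q[(fun x => (M + f x)%R) \o Z] = M%:E + 'E_Q[f \o Z] /\
      'E_Q[(fun x => (M - f x)%R) \o Z] = M%:E - 'E_Q[f \o Z])%E.
  move=> mZ; have cM : cst M \in Lfun Q 1 by exact: Lfun_cst.
  rewrite -(expectation_cst Q M) -expectationD ?lfun// -expectationB ?lfun//.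
have Efin dd (S : measurableType dd) (Q : probability S R) (Z : S -> E) :
    borel_fun Z -> ('E_Q[f \o Z] \is a fin_num)%E.
  by move=> mZ; rewrite expectation_fin_num ?lfun.
have lo : forall g : E -> R, continuous g -> (forall x, 0 <= g x) ->
   ('E_P'[g \o X'] <= limn_einf (fun n => 'E_(P n)[g \o @X n]))%E.
  exact: expectation_liminf.
have lo1 : ('E_P'[(fun x => (M + f x)%R) \o X'] <=
    limn_einf (fun n => 'E_(P n)[(fun x => (M + f x)%R) \o @X n]))%E.
  apply: lo => [x|x]; first by apply: cvgD; [exact: cvg_cst|exact: cf].
  by rewrite -lerBlDl sub0r; have := fM x; rewrite ler_norml => /andP[].
have lo2 : ('E_P'[(fun x => (M - f x)%R) \o X'] <=
    limn_einf (fun n => 'E_(P n)[(fun x => (M - f x)%R) \o @X n]))%E.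
  apply: lo => [x|x]; first by apply: cvgB; [exact: cvg_cst|exact: cf].
  by rewrite subr_ge0; have := fM x; rewrite ler_norml => /andP[].
have -> : (fun n => 'E_(P n)[f \o @X n])%E =
    EFin \o (fun n => fine 'E_(P n)[f \o @X n]%E).
  by apply/funext => n /=; rewrite fineK// Efin.
rewrite -(fineK (Efin _ _ P' X' mX')).
apply: cvg_EFin; first by near=> n.
apply/cvgrPdist_le => e e0.
have near1 := @near_le_limn_einf _ _ (M + fine 'E_P'[f \o X']%E) e e0.
have near2 := @near_le_limn_einf _ _ (M - fine 'E_P'[f \o X']%E) e e0.
have /near1 near1' : ((M + fine 'E_P'[f \o X']%E)%:E <=
    limn_einf (fun n => 'E_(P n)[(fun x => (M + f x)%R) \o @X n]))%E.
  by rewrite EFinD fineK ?Efin//; rewrite -(EM _ _ P' X' mX').1.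
have /near2 near2' : ((M - fine 'E_P'[f \o X']%E)%:E <=
    limn_einf (fun n => 'E_(P n)[(fun x => (M - f x)%R) \o @X n]))%E.
  by rewrite EFinB fineK ?Efin//; rewrite -(EM _ _ P' X' mX').2.
near=> n.
have : ((M + fine 'E_P'[f \o X']%E - e)%:E <= 'E_(P n)[(fun x => (M + f x)%R) \o @X n])%E.
  by near: n.
have : ((M - fine 'E_P'[f \o X']%E - e)%:E <= 'E_(P n)[(fun x => (M - f x)%R) \o @X n])%E.
  by near: n.
rewrite (EM _ _ _ _ (mX n)).1 (EM _ _ _ _ (mX n)).2 /=.
rewrite -(fineK (Efin _ _ (P n) (@X n) (mX n))) /= !lee_fin => H1 H2.
rewrite ler_norml; apply/andP; split; lra.
Unshelve. all: by end_near. Qed.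

End portmanteau.

(** * Measurability of the trees *)

Lemma measurable_exists d (T : measurableType d) (I : countType) (F : I -> set T) :
  (forall i, measurable (F i)) -> measurable [set w | exists i, F i w].
Proof.
move=> mF; rewrite (_ : [set w | _] = \bigcup_i F i); last first.
  by apply/seteqP; split => w; [move=> [i]|move=> [i _]]; exists i.
exact: countable_bigcupT_measurable.
Qed.

Lemma measurable_forall d (T : measurableType d) (I : countType) (F : I -> set T) :
  (forall i, measurable (F i)) -> measurable [set w | forall i, F i w].
Proof.
move=> mF; rewrite (_ : [set w | _] = ~` [set w | exists i, (~` F i) w]).
  by apply/measurableC/measurable_exists => i; exact: measurableC.
apply/seteqP; split => w /=; first by move=> Fw [i]; apply; exact: Fw.
by move=> /forallNP nF i; apply: contrapT; exact: nF.
Qed.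

Lemma open_rV_box (R : realType) (m : nat) (U : set 'rV[(nat * R)%type]_m) x :
  open U -> U x -> exists2 e : R, 0 < e & forall y : 'rV_m,
    (forall k, (y ord0 k).1 = (x ord0 k).1 /\
               `|(x ord0 k).2 - (y ord0 k).2| < e) -> U y.
Proof.
move=> oU Ux; have [Q Qx QU] : nbhs x U by exact: open_nbhs_nbhs.
have : \forall e \near (0 : R)^'+, forall k, forall z : nat * R,
    z.1 = (x ord0 k).1 -> `|(x ord0 k).2 - z.2| < e -> Q ord0 k z.
  apply: filter_forall => k.
  have [[A B] [/= Ax Bx] ABQ] := Qx ord0 k.
  have /nbhs_ballP[e /= e0 eB] := Bx.
  near=> r => z z1 zr; apply: ABQ; split => /=.
    by rewrite z1; exact: nbhs_singleton.
  apply: eB; rewrite /ball/=; apply: lt_le_trans zr _.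
  by near: r; exact: nbhs_right_le.
move=> H; near (0 : R)^'+ => e; exists e => // y xy.
apply: QU => i k; rewrite ord1; have [xy1 xy2] := xy k.
by move: k (y 0 k) xy1 xy2 {xy}; near: e.
Unshelve. all: by end_near. Qed.

(** Second countability: an open set is the union of the countably many boxes it contains that have
    prescribed discrete parts, rational centres and radii 1/(n+1). *)
Lemma borel_fun_rV d (T : measurableType d) (R : realType) (m : nat)
    (X : T -> 'rV[(nat * R)%type]_m) :
  (forall k i, measurable [set w | (X w ord0 k).1 = i]) ->
  (forall k, measurable_fun setT (fun w => (X w ord0 k).2)) ->
  borel_fun X.
Proof.
move=> m1 m2 U oU.
pose B (c : {ffun 'I_m -> nat * rat} * nat) : set 'rV[(nat * R)%type]_m :=
  [set x | forall k, (x ord0 k).1 = (c.1 k).1 /\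
     `|(x ord0 k).2 - ratr (c.1 k).2| < c.2.+1%:R^-1].
have -> : X @^-1` U = \bigcup_c (if `[< B c `<=` U >] then X @^-1` B c else set0).
  apply/seteqP; split => [w Uw|w [c _]]; last by case: asboolP => // BU /BU.
  have [e e0 eU] := open_rV_box oU Uw.
  (* The rational centre is within 1/(n+1) of the point and the box has the same radius, so the
     whole box stays within e of the point. *)
  have [n ne] : exists n : nat, n.+1%:R^-1 < e / 2.
    have /= [n _] := near_infty_natSinv_lt (PosNum (divr_gt0 e0 (ltr0n R 2))).
    by move=> /(_ n (leqnn n)); exists n.
  have qP k : exists q : rat, `|(X w ord0 k).2 - ratr q| < n.+1%:R^-1.
    have [q] := @rat_in_itvoo R ((X w ord0 k).2 - n.+1%:R^-1)
      ((X w ord0 k).2 + n.+1%:R^-1) ltac:(by rewrite ltrBlDr -addrA ltrDl addr_gt0).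
    by rewrite in_itv/= => qP; exists q; rewrite ltr_distlC.
  pose c : {ffun 'I_m -> nat * rat} := [ffun k => ((X w ord0 k).1, sval (cid (qP k)))].
  have Bc : B (c, n) (X w).
    by move=> k; rewrite /= ffunE /=; split => //; exact: svalP (cid (qP k)).
  exists (c, n) => //; case: asboolP => // -[] y By; apply: eU => k.
  have [y1 y2] := By k; have [x1 x2] := Bc k.
  split; first by rewrite y1 x1.
  rewrite -[_ - (y ord0 k).2](subrKA (ratr (c k).2)).
  apply: (le_lt_trans (ler_normD _ _)); rewrite (distrC (ratr _)).
  by rewrite [e]splitr ltrD// (lt_trans _ ne).
apply: countable_bigcupT_measurable => [|c]; first exact: countableP.
case: ifP => // _.
apply: measurable_forall => k; apply: measurableI; first exact: m1.
rewrite -[X in measurable X]setTI.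
apply: (m2 k measurableT [set r | `|r - ratr (c.1 k).2| < c.2.+1%:R^-1]).
rewrite (_ : [set r | _] = ball (ratr (c.1 k).2 : R) c.2.+1%:R^-1).
  exact: measurable_ball.
by apply/seteqP; split => r; rewrite /ball/= distrC.
Qed.

(** The finitely many Boolean tests cut the space into finitely many measurable atoms, and a set
    that does not separate the points of an atom is a union of atoms. *)
Lemma measurable_finite_table d (T : measurableType d) (I : finType)
    (c : I -> T -> bool) (A : set T) :
  (forall i, measurable [set w | c i w]) ->
  (forall w w', (forall i, c i w = c i w') -> A w -> A w') -> measurable A.
Proof.
move=> mc cA.
rewrite (_ : A = [set w | exists t : {ffun I -> bool},
    (if `[< exists2 w', A w' & forall i, c i w' = t i >]
     then [set w | forall i, c i w = t i] else set0) w]); last first.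
  apply/seteqP; split => w /=.
    move=> Aw; exists [ffun i => c i w].
    case: asboolP => [_ i|[]]; first by rewrite ffunE.
    by exists w => // i; rewrite ffunE.
  move=> [t]; case: asboolP => // -[w' Aw' w't] wt; apply: cA Aw' => i.
  by rewrite w't wt.
apply: measurable_exists => t; case: ifP => // _.
apply: measurable_forall => i; case: (t i).
  exact: mc.
rewrite (_ : (fun w => _) = ~` [set w | c i w]); first exact: measurableC.
by apply/seteqP; split => w /=; case: (c i w).
Qed.

Lemma measurable_fun_select d (T : measurableType d) d' (U : measurableType d')
    (D : countType) (F : T -> D) (G : D -> T -> U) :
  (forall v, measurable [set w | F w = v]) ->
  (forall v, measurable_fun setT (G v)) ->
  measurable_fun setT (fun w => G (F w) w).
Proof.
move=> mF mG _ B mB; rewrite setTI.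
rewrite (_ : _ @^-1` _ = [set w | exists v,
    ([set w | F w = v] `&` G v @^-1` B) w]); last first.
  by apply/seteqP; split => w /=; [exists (F w)|move=> [v [->]]].
apply: measurable_exists => v; apply: measurableI => //.
by rewrite -[X in measurable X]setTI; exact: mG.
Qed.

Lemma measurable_le_fun d (T : measurableType d) (R : realType) (f g : T -> R) :
  measurable_fun setT f -> measurable_fun setT g ->
  measurable [set w | f w <= g w].
Proof.
move=> mf mg; have := measurable_fun_ler mf mg => /(_ measurableT [set true]).
by rewrite setTI; apply.
Qed.

Section fpp_measurability.
Context (R : realType) (N : nat) d (T : measurableType d)
  (Y : {set 'I_N.+1} -> T -> R).
Hypothesis mY : forall e, measurable_fun setT (Y e).
Local Notation y w := (fun e => Y e w).

Lemma measurable_path_weight i (p : seq 'I_N.+1) :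
  measurable_fun setT (fun w => path_weight (y w) i p).
Proof.
rewrite /path_weight; elim: p i => [|j p IHp] i /=.
  by under eq_fun do rewrite big_nil; exact: measurable_cst.
under eq_fun do rewrite big_cons.
exact: measurable_funD.
Qed.

(** Optimal paths, the order of the vertices and the parents depend on the weights only through the
    finitely many comparisons between weights of paths from [ord0]. *)
Definition same_table (x z : {set 'I_N.+1} -> R) : Prop :=
  forall p q : {bseq N of 'I_N.+1},
    (path_weight x ord0 p <= path_weight x ord0 q) =
    (path_weight z ord0 p <= path_weight z ord0 q).

Lemma same_table_optimal_path x z j : same_table x z ->
  optimal_path x ord0 j = optimal_path z ord0 j.
Proof.
move=> xz; rewrite /optimal_path /Order.arg_min /extremum.
congr odflt; apply: eq_pick => p /=; congr (_ && _).
by apply: eq_forallb => q; rewrite xz.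
Qed.

Lemma same_table_fpp_order x z : same_table x z -> fpp_order x = fpp_order z.
Proof.
move=> xz; rewrite /fpp_order; congr (_ :: _); congr (sort _ _).
apply/funext => a; apply/funext => b.
by rewrite /fpp_dist !(same_table_optimal_path _ xz).
Qed.

Lemma same_table_fpp_vertex x z k : same_table x z -> fpp_vertex x k = fpp_vertex z k.
Proof. by move=> xz; rewrite /fpp_vertex (same_table_fpp_order xz). Qed.

Lemma same_table_fpp_parent x z k : same_table x z -> fpp_parent x k = fpp_parent z k.
Proof.
move=> xz; rewrite /fpp_parent /fpp_predecessor (same_table_fpp_vertex _ xz).
by rewrite (same_table_optimal_path _ xz) (same_table_fpp_order xz).
Qed.

Lemma measurable_same_table (A : set ({set 'I_N.+1} -> R)) :
  (forall x z, same_table x z -> A x -> A z) -> measurable [set w | A (y w)].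
Proof.
move=> xzA.
apply: (@measurable_finite_table _ _ ({bseq N of 'I_N.+1} * {bseq N of 'I_N.+1})%type
  (fun pq w => path_weight (y w) ord0 pq.1 <= path_weight (y w) ord0 pq.2)).
  by move=> pq; apply: measurable_le_fun; exact: measurable_path_weight.
by move=> w w' ww'; apply: xzA => p q; exact: ww' (p, q).
Qed.

Lemma borel_fun_fpp_tree (s : R) (m : nat) :
  borel_fun (fun w => fpp_tree s (y w) m).
Proof.
apply: borel_fun_rV => [k i|k].
  under eq_set do rewrite mxE /=.
  apply: (measurable_same_table (A := [set x | fpp_parent x k.+1 = i])).
  by move=> x z xz /=; rewrite (same_table_fpp_parent _ xz).
under eq_fun do rewrite mxE /= /fpp_weight.
apply: measurable_funM => //.
apply: (@measurable_fun_select _ _ _ _ _ (fun w =>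
    [set fpp_vertex (y w) (fpp_parent (y w) k.+1); fpp_vertex (y w) k.+1]%SET)
  (fun e w => Y e w `^ s^-1)) => [e|e].
  apply: (measurable_same_table (A := [set x |
    [set fpp_vertex x (fpp_parent x k.+1); fpp_vertex x k.+1]%SET = e])).
  move=> x z xz /= <-.
  by rewrite !(same_table_fpp_vertex _ xz) (same_table_fpp_parent _ xz).
exact: (measurableT_comp (@measurable_powR R s^-1) (mY e)).
Qed.

End fpp_measurability.

Section ip_measurability.
Context (R : realType) d (T : measurableType d) (X : vertex -> T -> R).
Hypothesis mX : forall v, measurable_fun setT (X v).
Local Notation x w := (fun v => X v w).

Lemma measurable_is_next S v : measurable [set w | is_next (x w) S v].
Proof.
rewrite /is_next; have [bv|bv] := boolP (on_boundary S v); last first.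
  by rewrite (_ : [set w | _] = set0)//; apply/seteqP; split => w //= -[].
rewrite (_ : [set w | _] = [set w | forall u,
    (if on_boundary S u then [set w | X v w <= X u w] else setT) w]); last first.
  apply/seteqP; split => w /=.
    by move=> [_ vP] u; case: ifP => // /vP.
  by move=> vP; split => // u bu; have := vP u; rewrite bu.
apply: measurable_forall => u; case: ifP => // _.
exact: measurable_le_fun.
Qed.

(** Turns the choice into quantifiers over the countable type of vertices, from which measurability
    can be read off. *)
Lemma next_vertexE z S (v : vertex) : next_vertex (R := R) z S = v <->
  (is_next z S v /\ forall u, is_next z S u -> (choice.pickle v <= choice.pickle u)%N) \/
  (v = [::] /\ forall u, ~ is_next z S u).
Proof.
rewrite /next_vertex; case: pselect => [h|nh].
  case: ex_minnP => c /asboolP[u uc zu] cmin.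
  have -> : odflt [::] (choice.unpickle c) = u by rewrite -uc choice.pickleK.
  split=> [<-|[[zv vmin]|[_ /(_ u)]]//].
    left; split => // u' zu'; rewrite uc; apply: cmin; apply/asboolP.
    by exists u'.
  apply: (pcan_inj (@choice.pickleK _)); apply/eqP; rewrite eqn_leq vmin// andbT uc.
  by apply: cmin; apply/asboolP; exists v.
have nn u : ~ is_next z S u.
  by move=> zu; apply: nh; exists (choice.pickle u); apply/asboolP; exists u.
split=> [<-|[[/nn//]|[]//]]; by right.
Qed.

Lemma measurable_next_vertex S v : measurable [set w | next_vertex (x w) S = v].
Proof.
rewrite (_ : [set w | _] = ([set w | is_next (x w) S v] `&`
    [set w | forall u, (if (choice.pickle v <= choice.pickle u)%N then setT else
                        ~` [set w | is_next (x w) S u]) w]) `|`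
    (if v == [::] then [set w | forall u, (~` [set w | is_next (x w) S u]) w]
     else set0)).
  apply: measurableU.
    apply: measurableI; first exact: measurable_is_next.
    apply: measurable_forall => u; case: ifP => // _.
    by apply: measurableC; exact: measurable_is_next.
  case: ifP => // _; apply: measurable_forall => u.
  by apply: measurableC; exact: measurable_is_next.
apply/seteqP; split => w /=; rewrite next_vertexE.
  move=> [[wv vP]|[-> nP]]; [left|by right].
  by split => // u; case: ifPn => //= uv /vP; rewrite (negbTE uv).
move=> [[wv vP]|b]; [left|right].
  by split => // u wu; have := vP u; case: ifPn => // _ /(_ wu).
by move: b; case: eqP.
Qed.

Lemma measurable_IP k S : measurable [set w | IP (x w) k = S].
Proof.
elim: k S => [|k IHk] S /=.
  have [<-|nS] := pselect ([:: [::]] = S).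
    by rewrite (_ : [set w | _] = setT)//; apply/seteqP; split.
  by rewrite (_ : [set w | _] = set0)//; apply/seteqP; split.
rewrite (_ : [set w | _] = [set w | exists S', ([set w | IP (x w) k = S'] `&`
    [set w | exists v, (if rcons S' v == S then [set w | next_vertex (x w) S' = v]
                        else set0) w]) w]).
  apply: measurable_exists => S'; apply: measurableI => //.
  apply: measurable_exists => v; case: ifP => // _.
  exact: measurable_next_vertex.
apply/seteqP; split => w /=.
  move=> <-; exists (IP (x w) k); split => //.
  by exists (next_vertex (x w) (IP (x w) k)); rewrite eqxx.
by move=> [S' [-> [v]]]; case: eqP => // <- /= ->.
Qed.

Lemma borel_fun_ip_tree (m : nat) : borel_fun (fun w => ip_tree (x w) m).
Proof.
apply: borel_fun_rV => [k i|k].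
  rewrite (_ : [set w | _] = [set w | exists S,
     (if index (parent (last [::] S)) S == i then [set w | IP (x w) k.+1 = S]
      else set0) w]).
    by apply: measurable_exists => S; case: ifP => // _; exact: measurable_IP.
  apply/seteqP; split => w; rewrite /= mxE /= /ip_parent /ip_vertex.
    by move=> <-; exists (IP (x w) k.+1); rewrite eqxx.
  by move=> [S]; case: eqP => // <- /= ->.
under eq_fun do rewrite mxE /=.
apply: (@measurable_fun_select _ _ _ _ _ (fun w => ip_vertex (x w) k.+1)) => // v.
rewrite (_ : [set w | _] = [set w | exists S,
     (if last [::] S == v then [set w | IP (x w) k.+1 = S] else set0) w]).
  by apply: measurable_exists => S; case: ifP => // _; exact: measurable_IP.
apply/seteqP; split => w; rewrite /= /ip_vertex.
  by move=> <-; exists (IP (x w) k.+1); rewrite eqxx.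
by move=> [S]; case: eqP => // <- /= ->.
Qed.

End ip_measurability.

(** * Cells of a Poisson process *)

Definition cell (R : realType) (h : R) (a : nat) : set R :=
  `]h * a%:R, h * a.+1%:R].

Lemma measurable_cell (R : realType) (h : R) a : measurable (cell h a).
Proof. exact: measurable_itv. Qed.

Lemma cell_gt0 (R : realType) (h : R) a : 0 < h -> cell h a `<=` `]0, +oo[.
Proof.
move=> h0 r; rewrite /cell /= !in_itv/= andbT => /andP[+ _].
by apply: le_lt_trans; rewrite mulr_ge0// ltW.
Qed.

Lemma cell_inj (R : realType) (h : R) a b r : 0 < h ->
  cell h a r -> cell h b r -> a = b.
Proof.
move=> h0; rewrite /cell /= !in_itv/= => /andP[a1 a2] /andP[b1 b2].
have := lt_le_trans a1 b2; have := lt_le_trans b1 a2.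
by rewrite !ltr_pM2l// !ltr_nat !ltnS => ba ab; apply/eqP; rewrite eqn_leq ab ba.
Qed.

Lemma cell_ex (R : realType) (h r : R) : 0 < h -> 0 < r -> exists a, cell h a r.
Proof.
move=> h0 r0.
have ex : exists n, r <= h * n.+1%:R.
  exists (Num.bound (r / h)); rewrite mulrC -ler_pdivrMr//.
  apply: (le_trans (ltW (archi_boundP _))); first by rewrite divr_ge0// ltW.
  by rewrite ler_nat.
case: (ex_minnP ex) => a ra amin; exists a; rewrite /cell /= in_itv/= ra andbT.
case: a ra amin => [|a] ra amin; first by rewrite mulr0.
by rewrite ltNge; apply/negP => /amin; rewrite ltnn.
Qed.

Lemma trivIset_cell (R : realType) (h : R) : 0 < h -> trivIset setT (cell h).
Proof.
by move=> h0; apply/trivIsetP => i j _ _ ij; apply/seteqP; split => // r [ri rj];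
  move/eqP: ij; apply; exact: cell_inj ri rj.
Qed.

Lemma lebesgue_measure_cell (R : realType) (h : R) a : 0 < h ->
  lebesgue_measure (cell h a) = h%:E.
Proof.
move=> h0; rewrite /cell lebesgue_measure_itv/= lte_fin ltr_pM2l// ltr_nat ltnSn.
by rewrite -EFinB -mulrBr -natrB// subSnn mulr1.
Qed.

Section ordered_poisson_points_cells.
Context d (T : measurableType d) (R : realType) (P : probability T R)
  (X : nat -> {RV P >-> R}) (h : R).
Hypotheses (ppX : ordered_poisson_points X) (h0 : 0 < h).
Local Notation npts A := (fun w => counting [set k | A (X k w)] : \bar R).

Definition hit (x : nat -> T -> R) a : set T := [set w | exists k, cell h a (x k w)].

Definition hit_once (x : nat -> T -> R) a : set T := [set w | exists k,
  cell h a (x k w) /\ forall l, l = k \/ ~ cell h a (x l w)].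

Lemma npts_miss a : ~` hit X a = [set w | npts (cell h a) w = 0%:R%:E].
Proof.
apply/seteqP; split => w /=; rewrite /hit/= /counting.
  move=> nw; have -> : [set k | cell h a (X k w)] = set0.
    by apply/seteqP; split => // k /= kw; apply: nw; exists k.
  by rewrite asboolT// fset_set0.
case: asboolP => // fw [] /eqP; rewrite pnatr_eq0 cardfs_eq0 => /eqP w0 [k kw].
have : k \in fset_set [set k | cell h a (X k w)] by rewrite in_fset_set ?mem_set.
by rewrite w0 in_fset0.
Qed.

Lemma npts_once a : hit_once X a = [set w | npts (cell h a) w = 1%:R%:E].
Proof.
apply/seteqP; split => w /=; rewrite /hit_once/= /counting.
  move=> [k [kw kP]]; have -> : [set k | cell h a (X k w)] = [set k].
    by apply/seteqP; split => [l /= lw|l ->//]; have [|/(_ lw)] := kP l.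
  by rewrite asboolT// fset_set1 cardfs1.
case: asboolP => // fw [] /eqP; rewrite eqr_nat => /cardfs1P[k kP].
have kE l : cell h a (X l w) <-> l = k.
  split => [lw|->].
    have : l \in fset_set [set k | cell h a (X k w)] by rewrite in_fset_set ?mem_set.
    by rewrite kP in_fset1 => /eqP.
  have : k \in fset_set [set k | cell h a (X k w)] by rewrite kP in_fset1.
  by rewrite in_fset_set// => /set_mem.
exists k; split; first exact/kE.
by move=> l; have [->|lk] := pselect (l = k); [left|right => /kE].
Qed.

Lemma probability_npts a j :
  P [set w | npts (cell h a) w = j%:R%:E] = (poisson_pmf h j)%:E.
Proof.
have [_ + _ _] := ppX => /(_ _ (measurable_cell h a) (@cell_gt0 _ _ a h0)).
rewrite (lebesgue_measure_cell _ h0) ltry => /(_ isT j) ->.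
by rewrite /poisson_prob /= h0 esum_set1// lee_fin poisson_pmf_ge0.
Qed.

Lemma measurable_hit a : measurable (hit X a).
Proof.
apply: measurable_exists => k; rewrite -[X in measurable X]setTI.
by apply: measurable_funP => //; exact: measurable_cell.
Qed.

Lemma measurable_hit_once a : measurable (hit_once X a).
Proof.
have mk k : measurable [set w | cell h a (X k w)].
  rewrite -[X in measurable X]setTI.
  by apply: measurable_funP => //; exact: measurable_cell.
apply: measurable_exists => k; apply: measurableI; first exact: mk.
apply: (measurable_forall (F := fun l w => l = k \/ ~ cell h a (X l w))) => l.
have [lk|lk] := pselect (l = k).
  by rewrite (_ : (fun w => _) = setT)//; apply/seteqP; split => // w _; left.
rewrite (_ : (fun w => _) = ~` [set w | cell h a (X l w)]); first exact: measurableC.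
by apply/seteqP; split => w /=; [case|right].
Qed.

Lemma probability_miss a : P (~` hit X a) = (expR (- h))%:E.
Proof. by rewrite npts_miss probability_npts /poisson_pmf h0 expr0 fact0 divr1 mul1r. Qed.

Lemma probability_hit a : P (hit X a) = (1 - expR (- h))%:E.
Proof.
rewrite -[hit X a]setCK probability_setC; last first.
  by apply: measurableC; exact: measurable_hit.
by rewrite probability_miss EFinB.
Qed.

Lemma probability_hit_le a : (P (hit X a) <= h%:E)%E.
Proof.
rewrite probability_hit lee_fin lerBlDr -lerBlDl.
by have := expR_ge1Dx (- h); lra.
Qed.

(** As e^-h >= 1 - h, one has 1 - (1 + h) e^-h <= 1 - (1 + h)(1 - h) = h^2. The quadratic order
    matters: summed over about 1/h cells it still vanishes with h, which excludes ties between
    siblings. *)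
Lemma probability_hit_twice a : (P (hit X a `\` hit_once X a) <= (h ^+ 2)%:E)%E.
Proof.
have sub : hit_once X a `<=` hit X a by move=> w [k [kw _]]; exists k.
rewrite measureD; [|exact: measurable_hit|exact: measurable_hit_once|]; last first.
  by apply: (le_lt_trans (probability_le1 _ _)); rewrite ?ltry//; exact: measurable_hit.
rewrite setIidr//.
apply: (@le_trans _ _ ((1 - expR (- h))%:E - (poisson_pmf h 1)%:E)%E).
  apply: leeB; first by rewrite -(probability_hit a).
  by rewrite npts_once -(probability_npts a 1).
rewrite /poisson_pmf h0 expr1 divr1 -EFinB lee_fin.
have := expR_ge1Dx (- h); have := h0; nra.
Qed.

End ordered_poisson_points_cells.

Section pwit_events.
Context d (T : measurableType d) (R : realType) (P : probability T R)
  (X : vertex -> {RV P >-> R}) (h : R).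
Hypotheses (pwX : is_PWIT X) (h0 : 0 < h).

Definition children (v : vertex) (k : nat) : T -> R := X (rcons v k).

Definition cell_event (v : vertex) a (b : option bool) : set T :=
  match b with
  | Some true => hit h (children v) a
  | Some false => ~` hit h (children v) a
  | None => setT
  end.

Lemma measurable_cell_event v a b : measurable (cell_event v a b).
Proof.
case: b => [[]|] //=; [|apply: measurableC]; exact: measurable_hit.
Qed.

Lemma cell_event_generated_npts v a b :
  generated_by (fun _ : unit =>
    (fun w => counting [set k | cell h a (X (rcons v k) w)] : \bar R))
  (cell_event v a b).
Proof.
pose G := \bigcup_(_ : unit) preimage_set_system setT
  (fun w => counting [set k | cell h a (X (rcons v k) w)] : \bar R) measurable.
have miss : @measurable _ (g_sigma_algebraType G) (~` hit h (children v) a).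
  rewrite (npts_miss (fun k => X (rcons v k))).
  apply: sub_gen_smallest; exists tt => //.
  exists [set 0%:R%:E]; first exact: emeasurable_set1.
  by rewrite setTI.
rewrite -[generated_by _ _]/(@measurable _ (g_sigma_algebraType G) _).
case: b => [[]|] //=.
by rewrite -[hit _ _ _]setCK; exact: measurableC.
Qed.

Lemma cell_event_generated v a b :
  generated_by (fun k : nat => X (rcons v k) : T -> R) (cell_event v a b).
Proof.
pose G := \bigcup_(k : nat) preimage_set_system setT
  (X (rcons v k) : T -> R) measurable.
have hitG : @measurable _ (g_sigma_algebraType G) (hit h (children v) a).
  apply: (@measurable_exists _ (g_sigma_algebraType G)) => k.
  apply: sub_gen_smallest; exists k => //.
  exists (cell h a); first exact: measurable_cell.
  by rewrite setTI.
rewrite -[generated_by _ _]/(@measurable _ (g_sigma_algebraType G) _).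
by case: b => [[]|] //=; exact: measurableC.
Qed.

Lemma cell_events_generated v (b : nat -> option bool) (r : seq nat) :
  generated_by (fun k : nat => X (rcons v k) : T -> R)
    (\bigcap_(a in [set` r]) cell_event v a (b a)).
Proof.
pose G := \bigcup_(k : nat) preimage_set_system setT
  (X (rcons v k) : T -> R) measurable.
rewrite -[generated_by _ _]/(@measurable _ (g_sigma_algebraType G) _).
by apply: bigcap_measurableType => a _; exact: cell_event_generated.
Qed.

(** Independence is used at two levels: the children of distinct vertices give the product over V,
    and the Poisson counts in disjoint cells give the product over r at each vertex. This is why
    cell events were placed in two generated sigma-algebras. *)
Lemma probability_cell_events (V : seq vertex) (r : seq nat)
    (b : vertex -> nat -> option bool) : uniq V -> uniq r ->
  P (\bigcap_(v in [set` V]) \bigcap_(a in [set` r]) cell_event v a (b v a)) =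
  (\prod_(v <- V) \prod_(a <- r) P (cell_event v a (b v a)))%E.
Proof.
have [ppX indX] := pwX.
move=> uV ur.
rewrite (indX V (fun v => \bigcap_(a in [set` r]) cell_event v a (b v a)) uV).
  apply: eq_bigr => v _; have [_ _ _ indp] := ppX v.
  have := indp (cell h) _ (trivIset_cell h0) r (fun a => cell_event v a (b v a)) ur.
  apply.
    by move=> i; split; [exact: measurable_cell|exact: cell_gt0].
  by move=> i _; split => //; exact: cell_event_generated_npts.
by move=> v _; split => //; exact: cell_events_generated.
Qed.

Lemma probability_cell_event v a b : P (cell_event v a b) =
  (match b with
   | Some true => 1 - expR (- h) | Some false => expR (- h) | None => 1
   end)%:E.
Proof.
have [ppX _] := pwX.
case: b => [[]|] /=; last by rewrite probability_setT.
  exact: (probability_hit (ppX v) h0).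
exact: (probability_miss (ppX v) h0).
Qed.

End pwit_events.

(** * Invasion percolation with generic weights *)

Lemma parent_rcons (u : vertex) k : parent (rcons u k) = u.
Proof. by rewrite /parent size_rcons /= -cats1 take_size_cat. Qed.

Lemma parentK (v : vertex) : v != [::] -> exists k, v = rcons (parent v) k.
Proof. by case/lastP: v => // u k _; exists k; rewrite parent_rcons. Qed.

(** A search among [(size S).+1] children always succeeds, by the pigeonhole principle. *)
Definition first_free (S : seq vertex) (u : vertex) : nat :=
  find (fun k => rcons u k \notin S) (iota 0 (size S).+1).

Lemma has_free S (u : vertex) :
  has (fun k => rcons u k \notin S) (iota 0 (size S).+1).
Proof.
apply/negPn/negP => /hasPn nf.
have : (size [seq rcons u k | k <- iota 0 (size S).+1] <= size S)%N.
  apply: uniq_leq_size.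
    by rewrite map_inj_uniq ?iota_uniq// => k l /rcons_inj[].
  by move=> _ /mapP[k ks ->]; have := nf _ ks; rewrite negbK.
by rewrite size_map size_iota ltnn.
Qed.

Lemma first_free_lt S u : (first_free S u < (size S).+1)%N.
Proof. by have := has_free S u; rewrite has_find size_iota. Qed.

Lemma first_free_notin S u : rcons u (first_free S u) \notin S.
Proof.
by have := nth_find 0%N (has_free S u); rewrite nth_iota ?add0n ?first_free_lt.
Qed.

Lemma before_first_free S u k : (k < first_free S u)%N -> rcons u k \in S.
Proof.
move=> kf; have := before_find 0%N kf; rewrite nth_iota ?add0n.
  by move/negbFE.
exact: ltn_trans kf (first_free_lt S u).
Qed.

Lemma first_free_le S u k : rcons u k \notin S -> (first_free S u <= k)%N.
Proof. by move=> kS; rewrite leqNgt; apply: contra kS => /before_first_free. Qed.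

Lemma on_boundary_rcons S u k :
  on_boundary S (rcons u k) = (rcons u k \notin S) && (u \in S).
Proof. by rewrite /on_boundary parent_rcons; case: u. Qed.

Section invasion_percolation.
Context (R : realType) (x : vertex -> R).

(** Only words [rcons v k] appear because the root carries no edge. Strict increase among siblings
    follows from the weak order together with distinctness. *)
Definition generic_weights : Prop :=
  [/\ forall v k, 0 < x (rcons v k),
      forall v k, x (rcons v k) <= x (rcons v k.+1) &
      forall u v k l, rcons u k <> rcons v l -> x (rcons u k) <> x (rcons v l)].

Hypothesis gx : generic_weights.

Lemma generic_le v k l : (k <= l)%N -> x (rcons v k) <= x (rcons v l).
Proof.
have [_ mono _] := gx.
elim: l => [|l IHl]; first by rewrite leqn0 => /eqP ->.
by rewrite leq_eqVlt => /predU1P[->//|kl]; exact: le_trans (IHl kl) (mono _ _).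
Qed.

Lemma generic_lt v k l : (k < l)%N -> x (rcons v k) < x (rcons v l).
Proof.
move=> kl; rewrite lt_neqAle generic_le ?(ltnW kl)// andbT.
have [_ _ dx] := gx; apply/eqP/dx => /rcons_inj[] kl'.
by rewrite kl' ltnn in kl.
Qed.

(** The boundary is infinite, but every boundary vertex is at least as heavy as the first free child
    of its parent, so a minimum over these finitely many candidates is enough. *)
Lemma is_next_ex S : [::] \in S -> exists v, is_next x S v.
Proof.
move=> S0; have S0' : (0 < size S)%N by case: S S0.
pose c (i : 'I_(size S)) := rcons (nth [::] S i) (first_free S (nth [::] S i)).
pose i0 : 'I_(size S) := Ordinal S0'.
have [i _ imin] := @arg_minP _ _ _ i0 xpredT (fun i => x (c i)) isT.
exists (c i); split.
  by rewrite on_boundary_rcons first_free_notin mem_nth.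
move=> u /and3P[u0 uS pS]; have [k uE] := parentK u0.
have ilt : (index (parent u) S < size S)%N by rewrite index_mem.
apply: (le_trans (imin (Ordinal ilt) isT)); rewrite /c /= nth_index//.
by rewrite [X in _ <= x X]uE; apply: generic_le; apply: first_free_le; rewrite -uE.
Qed.

Lemma next_vertexP S : [::] \in S -> is_next x S (next_vertex x S).
Proof.
move=> /is_next_ex [v xv]; have /next_vertexE : next_vertex x S = next_vertex x S by [].
by case=> [[]//|[_ /(_ v)]].
Qed.

(** Otherwise the first free child of the same parent would be a strictly lighter boundary
    vertex. *)
Lemma next_vertex_first_free S : [::] \in S ->
  next_vertex x S = rcons (parent (next_vertex x S))
                          (first_free S (parent (next_vertex x S))).
Proof.
move=> /next_vertexP[]; set v := next_vertex x S => /and3P[v0 vS pS] vmin.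
have [k vE] := parentK v0; rewrite {1}vE; congr rcons.
have := first_free_le (u := parent v) (k := k); rewrite -vE => /(_ _ vS).
rewrite leq_eqVlt => /predU1P[->//|lt_k].
have := vmin (rcons (parent v) (first_free S (parent v))).
rewrite on_boundary_rcons first_free_notin pS => /(_ isT).
by rewrite {1}vE leNgt generic_lt.
Qed.

Lemma size_IP k : size (IP x k) = k.+1.
Proof. by elim: k => //= k IHk; rewrite size_rcons IHk. Qed.

Lemma root_IP k : [::] \in IP x k.
Proof. by elim: k => //= k IHk; rewrite mem_rcons in_cons IHk orbT. Qed.

Lemma IP_cat k l : (k <= l)%N -> exists S, IP x l = IP x k ++ S.
Proof.
elim: l => [|l IHl]; first by rewrite leqn0 => /eqP ->; exists [::]; rewrite cats0.
rewrite leq_eqVlt => /predU1P[->|/IHl[S E]]; first by exists [::]; rewrite cats0.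
by exists (rcons S (next_vertex x (IP x l))); rewrite /= {1}E rcons_cat.
Qed.

Lemma ip_vertexS k : ip_vertex x k.+1 = next_vertex x (IP x k).
Proof. by rewrite /ip_vertex /= last_rcons. Qed.

Lemma nth_IP k l : (k <= l)%N -> nth [::] (IP x l) k = ip_vertex x k.
Proof.
move=> /IP_cat[S ->]; rewrite nth_cat size_IP ltnSn.
by rewrite /ip_vertex -nth_last size_IP; apply: set_nth_default; rewrite size_IP.
Qed.

Lemma uniq_IP k : uniq (IP x k).
Proof.
elim: k => //= k IHk; rewrite rcons_uniq IHk andbT.
by have [/and3P[]] := next_vertexP (root_IP k).
Qed.

Lemma ip_vertexP k : is_next x (IP x k) (ip_vertex x k.+1).
Proof. by rewrite ip_vertexS; exact: next_vertexP (root_IP k). Qed.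

Lemma ip_vertex_mem j k : (j <= k)%N -> ip_vertex x j \in IP x k.
Proof. by move=> jk; rewrite -(nth_IP jk) mem_nth// size_IP. Qed.

Lemma ip_vertex_fresh j k : (j <= k)%N -> ip_vertex x k.+1 \notin IP x j.
Proof.
move=> jk; have [/and3P[_ + _] _] := ip_vertexP k; apply: contra.
by have [S ->] := IP_cat jk; rewrite mem_cat => ->.
Qed.

Lemma parent_ip_vertex k : parent (ip_vertex x k.+1) \in IP x k.
Proof. by have [/and3P[]] := ip_vertexP k. Qed.

Lemma ip_parentE k : ip_parent x k.+1 = index (parent (ip_vertex x k.+1)) (IP x k).
Proof.
rewrite /ip_parent /= -cats1 index_cat.
by have := parent_ip_vertex k; rewrite ip_vertexS => ->.
Qed.

Lemma ip_parent_le k : (ip_parent x k.+1 <= k)%N.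
Proof. by rewrite -ltnS ip_parentE -{2}(size_IP k) index_mem parent_ip_vertex. Qed.

Lemma ip_vertex_parent k :
  parent (ip_vertex x k.+1) = ip_vertex x (ip_parent x k.+1).
Proof.
by rewrite -(nth_IP (ip_parent_le k)) ip_parentE nth_index// parent_ip_vertex.
Qed.

Lemma ip_parent_child j k : (j <= k)%N ->
  parent (ip_vertex x k.+1) = ip_vertex x j -> ip_parent x k.+1 = j.
Proof.
by move=> jk E; rewrite ip_parentE E -(nth_IP jk) index_uniq ?uniq_IP ?size_IP.
Qed.

Lemma ip_vertex_child k : exists c,
  ip_vertex x k.+1 = rcons (ip_vertex x (ip_parent x k.+1)) c.
Proof. by have [/and3P[/parentK + _ _]] := ip_vertexP k; rewrite ip_vertex_parent. Qed.

(** At step l the parent of vertex k + 1 is already present, so vertex k + 1 is on the boundary and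
    competes with the vertex that is chosen. *)
Lemma ip_weight_le k l : (ip_parent x k.+1 <= l)%N -> (l <= k)%N ->
  x (ip_vertex x l.+1) <= x (ip_vertex x k.+1).
Proof.
move=> pl lk; have [_] := ip_vertexP l; apply.
have [/and3P[k0 _ _] _] := ip_vertexP k.
by rewrite /on_boundary k0 ip_vertex_fresh// ip_vertex_parent ip_vertex_mem.
Qed.

End invasion_percolation.

(* The vertices explored by invasion percolation are determined by the
   sequence p of parents: among the children of a vertex, the smallest weight
   comes first. *)
Fixpoint tree_of (p : nat -> nat) (k : nat) : seq vertex :=
  if k is k'.+1 then
    let u := nth [::] (tree_of p k') (p k') in
    rcons (tree_of p k') (rcons u (first_free (tree_of p k') u))
  else [:: [::]].

Lemma size_tree_of p k : size (tree_of p k) = k.+1.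
Proof. by elim: k => //= k IHk; rewrite size_rcons IHk. Qed.

Lemma uniq_tree_of p k : uniq (tree_of p k).
Proof. by elim: k => //= k IHk; rewrite rcons_uniq IHk first_free_notin. Qed.

Lemma IP_tree_of (R : realType) (x : vertex -> R) p m : generic_weights x ->
  (forall k, (k < m)%N -> ip_parent x k.+1 = p k) -> IP x m = tree_of p m.
Proof.
move=> gx; elim: m => // m IHm pE /=.
rewrite -IHm; last by move=> k km; apply: pE; exact: ltnW.
congr rcons; rewrite next_vertex_first_free ?root_IP//.
rewrite -ip_vertexS ip_vertex_parent// pE// nth_IP//.
by rewrite -(pE m)// ip_parent_le.
Qed.

(** * Almost sure absence of ties in the Poisson-weighted infinite tree *)

Lemma ae_forall_countable d (T : measurableType d) (R : realType)
    (P : probability T R) (I : countType) (Q : I -> T -> Prop) :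
  (forall i, \forall w \ae P, Q i w) -> \forall w \ae P, forall i, Q i w.
Proof.
move=> aQ.
have : \forall w \ae P, forall n, (if choice.unpickle n is Some i then Q i else setT) w.
  apply: ae_foralln => n; case: (choice.unpickle n) => [i|]; first exact: aQ.
  exact: aeW.
by apply: filterS => w Qw i; have := Qw (choice.pickle i); rewrite choice.pickleK.
Qed.

Lemma probability_le_sum d (T : measurableType d) (R : realType)
    (P : probability T R) (A : set T) (F : nat -> set T) n (b : R) :
  measurable A -> (forall i, measurable (F i)) ->
  (forall w, A w -> exists2 i, (i < n)%N & F i w) ->
  (forall i, (P (F i) <= b%:E)%E) -> (P A <= (b *+ n)%:E)%E.
Proof.
move=> mA mF AF Fb.
apply: (@le_trans _ _ (\sum_(i < n) P (F i))%E).
  apply: content_subadditive => // w /AF[i ilt Fi].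
  by rewrite -bigcup_mkord; exists i.
rewrite -[X in b *+ X]card_ord -sumr_const -sumEFin.
by apply: lee_sum.
Qed.

Section pwit_generic.
Context d (T : measurableType d) (R : realType) (P : probability T R)
  (X : vertex -> {RV P >-> R}).
Hypothesis pwX : is_PWIT X.

Lemma measurable_cell_weight (h : R) v a : measurable [set w | cell h a (X v w)].
Proof.
rewrite -[X in measurable X]setTI.
by apply: measurable_funP => //; exact: measurable_cell.
Qed.

(** Siblings in one cell make that cell hit twice. For distinct parents, two independent events of
    probability at most h must occur. *)
Lemma pwit_tie_cell (h : R) u v k l i : 0 < h -> rcons u k <> rcons v l ->
  (P ([set w | cell h i (X (rcons u k) w)] `&`
      [set w | cell h i (X (rcons v l) w)]) <= (h ^+ 2)%:E)%E.
Proof.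
move=> h0 ukl; have [ppX _] := pwX.
have mI : measurable ([set w | cell h i (X (rcons u k) w)] `&`
      [set w | cell h i (X (rcons v l) w)]).
  by apply: measurableI; exact: measurable_cell_weight.
have [uv|/eqP uv] := pselect (u = v).
  rewrite -uv in ukl mI *.
  apply: le_trans (probability_hit_twice (ppX u) h0 i).
  apply: le_measure; [exact: mem_set|apply: mem_set|].
    apply: measurableD; first exact: measurable_hit.
    exact: measurable_hit_once.
  move=> w [kw lw]; split; first by exists k.
  move=> [j [jw jP]]; have [kj|//] := jP k; have [lj|//] := jP l.
  by apply: ukl; rewrite kj lj.
have /(_ [:: u; v] [:: i] (fun _ _ => Some true)) := probability_cell_events pwX h0.
rewrite /= !inE uv => /(_ isT isT) E.
apply: (@le_trans _ _ (P (\bigcap_(v0 in [set` [:: u; v]])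
   \bigcap_(a in [set` [:: i]]) hit h (children X v0) a))).
  apply: le_measure; [exact: mem_set|apply: mem_set|].
    rewrite bigcap_seq; apply: bigsetI_measurable => v0 _.
    rewrite bigcap_seq; apply: bigsetI_measurable => a _; exact: measurable_hit.
  move=> w [kw lw] v0; rewrite /= !inE => /orP[]/eqP -> a; rewrite /= inE => /eqP ->.
    by exists k.
  by exists l.
rewrite E !big_cons !big_nil !mule1 expr2 EFinM.
by apply: lee_pmul => //; exact: (probability_hit_le (ppX _) h0).
Qed.

(** A tie in (0, q] puts both weights in the same cell, whatever the mesh. Positivity is assumed
    because the cells cover only (0, oo). *)
Lemma pwit_no_tie u v k l : rcons u k <> rcons v l ->
  \forall w \ae P, 0 < X (rcons u k) w -> X (rcons u k) w <> X (rcons v l) w.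
Proof.
move=> ukl.
pose A q : set T := [set w | X (rcons u k) w = X (rcons v l) w] `&`
  ([set w | 0 < X (rcons u k) w] `&` [set w | X (rcons u k) w <= q%:R]).
have mA q : measurable (A q).
  apply: measurableI.
    rewrite (_ : [set w | _] = [set w | X (rcons u k) w <= X (rcons v l) w] `&`
        [set w | X (rcons v l) w <= X (rcons u k) w]).
      by apply: measurableI; exact: measurable_le_fun.
    apply/seteqP; split => w /= => [->//|[le1 le2]].
    by apply/eqP; rewrite eq_le le1 le2.
  apply: measurableI; last by exact: measurable_le_fun.
  rewrite (_ : [set w | _] = ~` [set w | X (rcons u k) w <= cst 0 w]).
    by apply: measurableC; exact: measurable_le_fun.
  by apply/seteqP; split => w /=; rewrite ltNge => /negP.
have A0 q : P (A q) = 0%E.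
  apply/eqP; rewrite -measure_le0; apply/lee_addgt0Pr => e e0; rewrite add0e.
  (* With mesh 1/r, the q r cells that meet (0, q] each contribute at most 1/r^2, in total q/r <=
     e. *)
  pose r := (Num.bound (q%:R / e)).+1; have r0 : 0 < r%:R :> R by rewrite ltr0n.
  have qre : q%:R / e < r%:R.
    have qe0 : 0 <= q%:R / e by rewrite divr_ge0// ltW.
    by apply: lt_le_trans (archi_boundP qe0) _; rewrite ler_nat.
  have h0 : 0 < r%:R^-1 :> R by rewrite invr_gt0.
  apply: (@le_trans _ _ ((r%:R^-1 ^+ 2) *+ (q * r))%:E).
    apply: (@probability_le_sum _ _ _ _ _
       (fun i => [set w | cell r%:R^-1 i (X (rcons u k) w)] `&`
      [set w | cell r%:R^-1 i (X (rcons v l) w)])) => //.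
    - by move=> i; apply: measurableI; exact: measurable_cell_weight.
    - move=> w [/= tie [w0 wq]]; have [i wi] := cell_ex h0 w0.
      exists i; last by split => //=; rewrite -tie.
      move: wi; rewrite /cell/= in_itv/= => /andP[wi _].
      have := lt_le_trans wi wq.
      by rewrite mulrC ltr_pdivrMr// -natrM ltr_nat.
    - by move=> i; exact: pwit_tie_cell.
  rewrite lee_fin -mulr_natr natrM mulrA expr2.
  have -> : r%:R^-1 / r%:R * q%:R * r%:R = q%:R / r%:R :> R.
    by field; rewrite gt_eqF.
  by rewrite ler_pdivrMr// mulrC -ler_pdivrMr// ltW.
have : \forall w \ae P, forall q, ~ A q w.
  apply: ae_foralln => q; exists (A q); split; [exact: mA|exact: A0|].
  by move=> w /contrapT.
apply: filterS => w nA w0 tie; apply: (nA (Num.bound (X (rcons u k) w))).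
by do !split => //; rewrite /= ltW// archi_boundP// ltW.
Qed.

Lemma pwit_generic : \forall w \ae P, generic_weights (fun v => X v w).
Proof.
have [ppX _] := pwX.
have pm : \forall w \ae P, forall v k, 0 < X (rcons v k) w /\
    X (rcons v k) w <= X (rcons v k.+1) w.
  by apply: ae_forall_countable => v; have [] := ppX v.
have nt : \forall w \ae P, forall c : (vertex * nat) * (vertex * nat),
    rcons c.1.1 c.1.2 <> rcons c.2.1 c.2.2 -> 0 < X (rcons c.1.1 c.1.2) w ->
    X (rcons c.1.1 c.1.2) w <> X (rcons c.2.1 c.2.2) w.
  apply: ae_forall_countable => -[[u k] [v l]] /=.
  have [E|/pwit_no_tie] := pselect (rcons u k = rcons v l); first exact: aeW.
  by apply: filterS => w + _.
apply: filterS2 pm nt => w wpm wnt; split.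
- by move=> v k; have [] := wpm v k.
- by move=> v k; have [] := wpm v k.
- move=> u v k l uv; apply: (wnt ((u, k), (v, l))) => //=.
  by have [] := wpm u k.
Qed.

End pwit_generic.

(** * Boxes of trees *)

Definition box (R : realType) m (h : R) (p a : nat -> nat) :
    set 'rV[(nat * R)%type]_m :=
  [set x | forall k : 'I_m, (x ord0 k).1 = p k /\ cell h (a k) (x ord0 k).2].

Definition gapped m (a : nat -> nat) : Prop := forall k l,
  (k < m)%N -> (l < m)%N -> k <> l -> ((a k).+2 <= a l \/ (a l).+2 <= a k)%N.

(** This is what invasion percolation forces on [(p, a)]: while vertex k + 1 waits on the boundary,
    only lighter edges are added, and under [gapped] lighter means at least two cells lower. *)
Definition consistent m (p a : nat -> nat) : Prop := forall k, (k < m)%N ->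
  (p k <= k)%N /\ forall l, (p k <= l)%N -> (l < k)%N -> ((a l).+2 <= a k)%N.

(* Vertex k + 1 of the tree is joined to vertex p k by an edge whose weight lies
   in cell a k; depth m a j is the largest cell used after the arrival of
   vertex j. *)
Definition depth m (a : nat -> nat) j : nat := \max_(j <= l < m) a l.

Lemma depth_gt m a j i : (i < depth m a j)%N ->
  exists l, [/\ (j <= l)%N, (l < m)%N & (i < a l)%N].
Proof.
move=> idep; apply: contrapT => /forallNP nl; move: idep; apply/negP; rewrite -leqNgt.
apply/bigmax_leqP_seq => l; rewrite mem_index_iota => /andP[jl lm] _.
by rewrite leqNgt; apply/negP => il; apply: (nl l).
Qed.

Lemma leq_depth m a j l : (j <= l)%N -> (l < m)%N -> (a l <= depth m a j)%N.
Proof.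
by move=> jl lm; apply: (leq_bigmax_seq l) => //; rewrite mem_index_iota jl lm.
Qed.

Definition has_child m (p a : nat -> nat) j i : bool :=
  has (fun l => (p l == j) && (a l == i)) (iota 0 m).

Definition label m (p a : nat -> nat) j i : option bool :=
  if has_child m p a j i then Some true
  else if (i < depth m a j)%N then Some false else None.

Lemma has_childP m p a j i :
  reflect (exists l, [/\ (l < m)%N, p l = j & a l = i]) (has_child m p a j i).
Proof.
apply: (iffP hasP) => [[l]|[l [lm pl al]]].
  by rewrite mem_iota add0n => lm /andP[/eqP pl /eqP al]; exists l.
by exists l; rewrite ?mem_iota ?add0n// pl al !eqxx.
Qed.

Section ip_box.
Context (R : realType) (x : vertex -> R) (h : R) (m : nat) (p a : nat -> nat).
Hypotheses (gx : generic_weights x) (h0 : 0 < h).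
Hypothesis xbox : box h p a (ip_tree x m).

Lemma ip_box_parent k : (k < m)%N -> ip_parent x k.+1 = p k.
Proof. by move=> km; have [] := xbox (Ordinal km); rewrite mxE. Qed.

Lemma ip_box_weight k : (k < m)%N -> cell h (a k) (x (ip_vertex x k.+1)).
Proof. by move=> km; have [] := xbox (Ordinal km); rewrite mxE. Qed.

Lemma cell_le b c r t : cell h b r -> cell h c t -> r <= t -> (b <= c)%N.
Proof.
rewrite /cell /= !in_itv/= => /andP[b1 _] /andP[_ c2] rt.
by have := lt_le_trans b1 (le_trans rt c2); rewrite ltr_pM2l// ltr_nat ltnS.
Qed.

Lemma ip_box_consistent : gapped m a -> consistent m p a.
Proof.
move=> ga k km; have pk : (p k <= k)%N by rewrite -(ip_box_parent km) ip_parent_le.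
split => // l pl lk; have lm := ltn_trans lk km.
have := cell_le (ip_box_weight lm) (ip_box_weight km).
rewrite ip_weight_le ?(ltnW lk)// ?ip_box_parent// => /(_ isT) alk.
by have := ga _ _ lm km; lia.
Qed.

(** A prescribed cell is hit by the tree vertex that prescribes it. A child of vertex j in another
    cell i < a l, with j <= l, would be lighter than vertex l + 1, so it was invaded before; but
    then its own cell is prescribed, a contradiction. *)
Lemma ip_box_label j i : (j < m)%N ->
  match label m p a j i with
  | Some true => exists c, cell h i (x (rcons (ip_vertex x j) c))
  | Some false => ~ exists c, cell h i (x (rcons (ip_vertex x j) c))
  | None => True
  end.
Proof.
move=> jm; rewrite /label; case: has_childP => [[l [lm pl al]]|nc].
  have [c cE] := ip_vertex_child gx l.
  exists c; rewrite -pl -(ip_box_parent lm) -cE -al; exact: ip_box_weight.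
case: ifPn => // /depth_gt[l [jl lm il]] [c xc].
have xlt : x (rcons (ip_vertex x j) c) < x (ip_vertex x l.+1).
  have := ip_box_weight lm; move: xc; rewrite /cell/= !in_itv/=.
  move=> /andP[_ c2] /andP[l1 _]; apply: le_lt_trans c2 (le_lt_trans _ l1).
  by rewrite ler_pM2l// ler_nat.
have : rcons (ip_vertex x j) c \in IP x l.
  apply: contraT => cl; have [_ /(_ (rcons (ip_vertex x j) c))] := ip_vertexP gx l.
  by rewrite on_boundary_rcons cl ip_vertex_mem// leNgt xlt => /(_ isT).
move=> /(nthP [::])[[|l']]; rewrite size_IP ltnS => l'l; rewrite nth_IP//.
  by rewrite /ip_vertex /=; case: (last _ _).
move=> cE; have l'm : (l' < m)%N by apply: leq_trans lm; exact: leq_trans l'l (leqnSn l).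
apply: nc; exists l'; split => //; last first.
  by apply: (cell_inj h0 (ip_box_weight l'm)); rewrite cE.
(* A vertex cannot be invaded before its parent, so the child has index l' + 1 with l' >= j, and its
   recorded parent is j. *)
have jl' : (j <= l')%N.
  rewrite leqNgt; apply/negP => l'j.
  have := uniq_IP gx j; have : ip_vertex x l'.+1 \in IP x j by exact: ip_vertex_mem.
  have := parent_ip_vertex gx l'; rewrite cE parent_rcons.
  case: j l'j {jm jl xc xlt cE} => // j l'j.
  by rewrite (negbTE (ip_vertex_fresh gx _)).
by rewrite -(ip_box_parent l'm); apply: ip_parent_child => //; rewrite cE parent_rcons.
Qed.

End ip_box.

(** The cells [a l] are pairwise distinct, so each edge accounts for exactly one pair (j, i). This
    count is the exponent m in the bound on the probability of a box. *)
Lemma sum_has_child m p a K : gapped m a ->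
  (forall k, (k < m)%N -> (p k < m)%N /\ (a k < K)%N) ->
  (\sum_(j <- iota 0 m) \sum_(i <- iota 0 K) has_child m p a j i)%N = m.
Proof.
move=> ga paK.
have hE j i : (has_child m p a j i : nat) =
    (\sum_(l <- iota 0 m) ((p l == j) && (a l == i)))%N.
  case: has_childP => [[l [lm pl al]]|nc] /=.
    rewrite (bigD1_seq l) ?mem_iota ?iota_uniq//= pl al !eqxx big1_seq//= => l'.
    rewrite mem_iota add0n => /andP[/eqP l'l l'm]; case: eqP => //= _.
    by apply/eqP; rewrite eqb0; apply/eqP; have := ga _ _ l'm lm l'l; lia.
  rewrite big1_seq// => l; rewrite mem_iota add0n => /= lm.
  by apply/eqP; rewrite eqb0; apply/negP => /andP[/eqP pl /eqP al]; apply: nc; exists l.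
under eq_bigr => j _ do under eq_bigr => i _ do rewrite hE.
under eq_bigr => j _ do rewrite exchange_big.
rewrite exchange_big -[RHS](size_iota 0) -sum1_size /=.
apply: eq_big_seq => l; rewrite mem_iota add0n => /= /paK[plm alK].
rewrite (bigD1_seq (p l)) ?mem_iota ?iota_uniq//= (bigD1_seq (a l)) ?mem_iota ?iota_uniq//=.
rewrite !eqxx/= !big1_seq//= => [j|i]; rewrite mem_iota => /andP[+ _].
  by rewrite eq_sym => /negbTE ->; rewrite big1.
by rewrite eq_sym => /negbTE ->.
Qed.

Lemma coord_rV_continuous (E : topologicalType) m (k : 'I_m) :
  continuous (fun x : 'rV[E]_m => x ord0 k).
Proof.
move=> x A Ax; exists (fun _ j => if j == k then A else setT).
  by move=> i j; rewrite ord1; case: eqP => [->//|_]; exact: filterT.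
by move=> y /(_ ord0 k); rewrite /= eqxx.
Qed.

Lemma measurable_box d (T : measurableType d) (R : realType) m (h : R) p a
    (Z : T -> 'rV[(nat * R)%type]_m) :
  borel_fun Z -> measurable (Z @^-1` box h p a).
Proof.
move=> mZ; apply: measurable_forall => k; apply: measurableI.
  rewrite (_ : (fun w => _) =
    Z @^-1` ((fun x => (x ord0 k).1) @^-1` [set p k])) //.
  apply: mZ; apply: open_comp => [x _|]; last exact: discrete_open.
  by apply: continuous_comp; [exact: coord_rV_continuous|exact: cvg_fst].
rewrite -[X in measurable X]setTI.
have c2 : continuous (fun x : 'rV[(nat * R)%type]_m => (x ord0 k).2).
  move=> x.
  by apply: continuous_comp; [exact: coord_rV_continuous|exact: cvg_snd].
exact: (borel_fun_continuous_comp mZ c2 measurableT (measurable_cell h (a k))).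
Qed.

Lemma probability_le_ae d (T : measurableType d) (R : realType)
    (P : probability T R) (A B : set T) :
  measurable A -> measurable B -> (\forall w \ae P, A w -> B w) ->
  (P A <= P B)%E.
Proof.
move=> mA mB [N [mN N0 ABN]].
apply: (@le_trans _ _ (P (B `|` N))).
  apply: le_measure; [exact: mem_set|by apply/mem_set/measurableU|].
  move=> w Aw; have [Bw|nBw] := pselect (B w); [by left|right].
  by apply: ABN => /= /(_ Aw).
by rewrite measureU0.
Qed.

Lemma sum_iota_lt D K : (D <= K)%N -> (\sum_(i <- iota 0 K) (i < D)%N)%N = D.
Proof.
move=> DK; rewrite -(subnKC DK) iotaD big_cat /= add0n.
rewrite (eq_big_seq (fun=> 1%N)); last first.
  by move=> i; rewrite mem_iota add0n => /= ->.
rewrite sum1_size size_iota big1_seq ?addn0// => i.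
by rewrite mem_iota => /= /andP[Di _]; rewrite ltnNge Di.
Qed.

(** * Upper bound on the probability of a box for invasion percolation *)

Section ip_box_probability.
Context d (T : measurableType d) (R : realType) (P : probability T R)
  (X : vertex -> {RV P >-> R}) (h : R) (m : nat) (p a : nat -> nat).
Hypotheses (pwX : is_PWIT X) (h0 : 0 < h) (ga : gapped m a).
Let tree w : 'rV[(nat * R)%type]_m := ip_tree (fun v => X v w) m.

Lemma measurable_ip_box : measurable (tree @^-1` box h p a).
Proof. by apply: measurable_box; exact: borel_fun_ip_tree. Qed.

Lemma probability_ip_box_inconsistent : ~ consistent m p a ->
  P (tree @^-1` box h p a) = 0%E.
Proof.
move=> nc; apply/eqP; rewrite -measure_le0 -(measure0 P).
apply: probability_le_ae; [exact: measurable_ip_box|exact: measurable0|].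
apply: filterS (pwit_generic pwX) => w gw wb; apply: nc.
exact: ip_box_consistent gw h0 wb ga.
Qed.

(** The box is almost surely contained in the event that all labels are respected at the first m
    vertices, and the probability of that event is a product over vertices and cells. *)
Lemma probability_ip_box_le : consistent m p a ->
  (P (tree @^-1` box h p a) <=
   ((h * expR h) ^+ m * expR (- h * (\sum_(j < m) depth m a j)%:R))%:E)%E.
Proof.
move=> cpa.
have [K aK] : exists K, forall k, (k < m)%N -> (a k < K)%N.
  by exists (depth m a 0).+1 => k km; rewrite ltnS leq_depth.
have pm k : (k < m)%N -> (p k < m)%N.
  by move=> km; have [pk _] := cpa _ km; exact: leq_ltn_trans pk km.
(* On the box the explored vertices are those of [tree_of p], so independence can be applied at
   deterministic vertices. The last vertex is left out: no edge is prescribed below it. *)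
pose V := take m (tree_of p m).
have sV : size V = m by rewrite size_take size_tree_of ltnSn.
have uV : uniq V by rewrite take_uniq// uniq_tree_of.
pose z (b : option bool) : R :=
  match b with Some true => 1 - expR (- h) | Some false => expR (- h) | None => 1 end.
apply: (@le_trans _ _ (P (\bigcap_(v in [set` V]) \bigcap_(i in [set` iota 0 K])
    cell_event X h v i (label m p a (index v V) i)))).
  apply: probability_le_ae; first exact: measurable_ip_box.
    rewrite bigcap_seq; apply: bigsetI_measurable => v _.
    rewrite bigcap_seq; apply: bigsetI_measurable => i _.
    exact: measurable_cell_event.
  apply: filterS (pwit_generic pwX) => w gw wb v /= vV i _.
  have jm : (index v V < m)%N by rewrite -[X in (_ < X)%N]sV index_mem.
  have := ip_box_label gw h0 wb i jm.
  have -> : ip_vertex (fun v => X v w) (index v V) = v.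
    rewrite -(nth_IP _ (ltnW jm)) (IP_tree_of gw (p := p)); last first.
      by move=> k km; exact: ip_box_parent wb _ km.
    by rewrite -(nth_take (n0 := m)) // -/V nth_index.
  by rewrite /cell_event; case: label => [[]|].
rewrite (probability_cell_events pwX h0)// ?iota_uniq//.
under eq_bigr => v _.
  under eq_bigr => i _ do rewrite (probability_cell_event pwX h0) -/(z _).
  rewrite prodEFin; over.
rewrite prodEFin lee_fin.
rewrite -{1}(mkseq_nth [::] V) sV /mkseq big_map.
rewrite (eq_big_seq (fun j => \prod_(i <- iota 0 K) z (label m p a j i))); last first.
  by move=> j; rewrite mem_iota add0n => /= jm; rewrite index_uniq ?sV.
have z_ge0 b : 0 <= z b.
  rewrite /z; case: b => [[]|]; [|exact: expR_ge0|exact: ler01].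
  by rewrite subr_ge0 -[leRHS]expR0 ler_expR oppr_le0 ltW.
(* A prescribed cell has probability at most h, which is h e^h e^-h below the depth and at most h
   e^h elsewhere. In this form every cell below the depth, prescribed or not, is charged e^-h. *)
apply: (@le_trans _ _ (\prod_(j <- iota 0 m) \prod_(i <- iota 0 K)
    ((h * expR h) ^+ has_child m p a j i * expR (- h) ^+ (i < depth m a j)%N))).
  apply: ler_prod => j _; apply/andP; split; first by apply: prodr_ge0.
  apply: ler_prod => i _; apply/andP; split; first exact: z_ge0.
  have e1 : 1 - expR (- h) <= h by have := expR_ge1Dx (- h); lra.
  rewrite /label; case: has_child => /=; last by case: ltnP; rewrite ?mul1r.
  rewrite expr1; case: ltnP => _ /=; rewrite ?expr1 ?expr0 ?mulr1.
    by rewrite -mulrA -expRD subrr expR0 mulr1.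
  apply: (le_trans e1); rewrite ler_peMr ?(ltW h0)//.
  by rewrite -[leLHS]expR0 ler_expR ltW.
under eq_bigr => j _ do rewrite big_split /= -!expr_sum.
rewrite big_split /= -!expr_sum.
rewrite (sum_has_child (a := a))//; last by move=> k km; rewrite pm ?aK.
rewrite -expRM_natr.
rewrite (eq_big_seq (fun j => depth m a j)).
  by rewrite -(big_mkord xpredT) /index_iota subn0.
move=> j _; rewrite sum_iota_lt//.
apply/bigmax_leqP_seq => l; rewrite mem_index_iota => /andP[_ lm] _.
exact/ltnW/aK.
Qed.

End ip_box_probability.

(** * First passage percolation around a given tree *)

Lemma sorted_filter_cat (T : eqType) (leT : rel T) (Q : pred T) (s : seq T) :
  transitive leT -> sorted leT s ->
  {in s &, forall x y, Q x -> ~~ Q y -> ~~ leT y x} ->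
  s = seq.filter Q s ++ seq.filter (predC Q) s.
Proof.
move=> trT; elim: s => //= x s IHs srt sep.
have {}IHs := IHs (path_sorted srt)
  (fun a b ain bin => sep a b (mem_behead (s := x :: s) ain) (mem_behead (s := x :: s) bin)).
case: ifPn => Qx /=; first by rewrite -IHs.
suff fs : seq.filter Q s = [::] by rewrite fs /= {1}IHs fs.
apply/eqP; rewrite -[_ == _]negbK -has_filter; apply/hasPn => y ys.
apply/negP => Qy; have := sep y x; rewrite !inE eqxx ys orbT => /(_ isT isT Qy Qx).
by have /allP/(_ y ys) -> := order_path_min trT srt.
Qed.

Section fpp_tree_of_weights.
Context (R : realType) (N m : nat) (y : {set 'I_N.+1} -> R).
Context (p : nat -> nat) (i : nat -> 'I_N.+1) (D : nat -> R).
Hypotheses (y_gt0 : forall u v, u != v -> 0 < y [set u; v]%SET)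
  (i0 : i 0%N = ord0)
  (i_inj : forall j k, (j <= m)%N -> (k <= m)%N -> i j = i k -> j = k)
  (p_le : forall k, (k < m)%N -> (p k <= k)%N)
  (D0 : D 0%N = 0)
  (DS : forall k, (k < m)%N -> D k.+1 = D (p k) + y [set i (p k); i k.+1]%SET)
  (D_lt : forall k, (k < m)%N -> D k < D k.+1)
  (non_tree : forall j k, (j <= k)%N -> (k < m)%N -> p k <> j ->
    D k.+1 < D j + y [set i j; i k.+1]%SET)
  (outside : forall j v, (j <= m)%N -> (forall k, (k <= m)%N -> v <> i k) ->
    D m < D j + y [set i j; v]%SET).

Let tree := [seq i k | k <- iota 0 m.+1].

Let treeP v : reflect (exists2 k, (k <= m)%N & v = i k) (v \in tree).
Proof.
apply: (iffP mapP) => -[k]; first by rewrite mem_iota add0n ltnS => km ->; exists k.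
by move=> km ->; exists k; rewrite ?mem_iota ?add0n ?ltnS.
Qed.

Let out_tree v : v \notin tree -> forall k, (k <= m)%N -> v <> i k.
Proof. by move=> vt k km vE; move/treeP: vt; apply; exists k. Qed.

Let D_le j k : (j <= k)%N -> (k <= m)%N -> D j <= D k.
Proof.
elim: k => [|k IHk]; first by rewrite leqn0 => /eqP ->.
rewrite leq_eqVlt => /predU1P[->//|jk km].
by apply: le_trans (IHk jk (ltnW km)) (ltW (D_lt km)).
Qed.

Let D_ltn j k : (j < k)%N -> (k <= m)%N -> D j < D k.
Proof.
case: k => // k; rewrite ltnS => jk km.
exact: le_lt_trans (D_le jk (ltnW km)) (D_lt km).
Qed.

Let D_inj j k : (j <= m)%N -> (k <= m)%N -> (D j <= D k) = (j <= k)%N.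
Proof.
move=> jm km; apply/idP/idP => [|jk]; last exact: D_le.
by apply: contraTT; rewrite -ltnNge -ltNge => kj; exact: D_ltn.
Qed.

(* The potential [phi] is the distance from ord0 on the tree and a lower bound
   for it outside; an edge increases it by at most its weight. *)
Let phi v : R := if v \in tree then D (index v tree) else D m.

Let phi_i k : (k <= m)%N -> phi (i k) = D k.
Proof.
move=> km; rewrite /phi; have -> : i k \in tree by apply/treeP; exists k.
have ks : (k < size tree)%N by rewrite size_map size_iota.
have {1}-> : i k = nth ord0 tree k.
  by rewrite (nth_map 0%N) ?size_iota// nth_iota.
rewrite index_uniq// map_inj_in_uniq ?iota_uniq// => u v.
by rewrite !mem_iota !add0n !ltnS => um vm; exact: i_inj.
Qed.

Let phi_out v : v \notin tree -> phi v = D m.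
Proof. by rewrite /phi => /negbTE ->. Qed.

Let phi_le v : phi v <= D m.
Proof.
have [/treeP[k km ->]|vt] := boolP (v \in tree); last by rewrite phi_out.
by rewrite phi_i// D_le.
Qed.

Let tree_edge u v := exists2 k, (k < m)%N & u = i (p k) /\ v = i k.+1.

(** Equality holds only on tree edges directed away from the root. This strictness identifies the
    last edge of an optimal path and keeps the outside vertices beyond distance [D m]. *)
Let phi_edge u v : u != v ->
  phi v < phi u + y [set u; v]%SET \/
  tree_edge u v /\ phi v = phi u + y [set u; v]%SET.
Proof.
move=> uv; have yuv := y_gt0 uv.
have [/treeP[j jm uE]|ut] := boolP (u \in tree); last first.
  by left; rewrite (phi_out ut); apply: le_lt_trans (phi_le v) _; rewrite ltrDl.
have [/treeP[k km vE]|vt] := boolP (v \in tree); last first.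
  by left; rewrite (phi_out vt) uE phi_i//; apply: outside => //; exact: out_tree.
rewrite uE vE !phi_i//.
have [kj|jk] := leqP k j.
  left; apply: le_lt_trans (D_le kj jm) _; rewrite ltrDl.
  by move: yuv; rewrite uE vE.
case: k km vE jk => // k km vE; rewrite ltnS => jk.
have [pj|pj] := pselect (p k = j).
  by right; split; [exists k => //; rewrite pj|rewrite DS// pj].
by left; exact: non_tree.
Qed.

Let path_weight_ge u q : uniq (u :: q) -> phi (last u q) <= phi u + path_weight y u q.
Proof.
rewrite /path_weight; elim: q u => [|v q IHq] u /=; first by rewrite big_nil addr0.
rewrite inE negb_or => /andP[/andP[uv uq] vq]; rewrite big_cons.
apply: (le_trans (IHq v vq)); rewrite addrA lerD2r.
by have [/ltW//|[_ ->]] := phi_edge uv.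
Qed.

Let path_weight_rcons u q v :
  path_weight y u (rcons q v) = path_weight y u q + y [set last u q; v]%SET.
Proof. by rewrite /path_weight -cats1 pairmap_cat big_cat /= big_seq1. Qed.

Let phi0 : phi ord0 = 0.
Proof. by rewrite -i0 phi_i. Qed.

Let path_weight_last q v : uniq (ord0 :: rcons q v) ->
  phi v < path_weight y ord0 (rcons q v) \/ tree_edge (last ord0 q) v.
Proof.
rewrite -rcons_cons rcons_uniq => /andP[vq uq]; rewrite path_weight_rcons.
have := path_weight_ge uq; rewrite phi0 add0r => le_q.
have lv : last ord0 q != v.
  by apply: contraNneq vq => <-; exact: mem_last.
have [lt_v|[]] := phi_edge lv; last by right.
by left; apply: lt_le_trans lt_v _; rewrite lerD2r.
Qed.

(** Strong induction through the parent. The clause on indices shows that [i k.+1] is new, which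
    keeps the extended path self-avoiding. *)
Let tree_path k : (k <= m)%N -> exists q, [/\ uniq (ord0 :: q), last ord0 q = i k,
  path_weight y ord0 q = D k &
  forall v, v \in q -> exists2 l, (0 < l <= k)%N & v = i l].
Proof.
elim/ltn_ind: k => -[|k] IHk km.
  by exists [::]; split => //; rewrite /path_weight ?big_nil.
have [q [uq lq wq qP]] := IHk (p k) (p_le km) (leq_trans (p_le km) (ltnW km)).
exists (rcons q (i k.+1)); split.
- rewrite -rcons_cons rcons_uniq uq andbT inE negb_or; apply/andP; split.
    by rewrite -i0; apply/eqP => /i_inj; move=> /(_ km isT).
  apply/negP => /qP[l /andP[l0 lp] kl].
  have lm : (l <= m)%N by apply: leq_trans lp (leq_trans (p_le km) (ltnW km)).
  by have := leq_trans lp (p_le km); rewrite -(i_inj km lm kl) ltnn.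
- by rewrite last_rcons.
- by rewrite path_weight_rcons lq wq DS.
- move=> v; rewrite mem_rcons inE => /predU1P[->|/qP[l /andP[l0 lp] ->]].
    by exists k.+1; rewrite ?ltnS ?leqnn.
  by exists l; rewrite // l0 (leq_trans lp)// (leq_trans (p_le km)).
Qed.

Let is_path_direct (j : 'I_N.+1) : is_path ord0 j (direct_path ord0 j).
Proof.
rewrite /is_path /direct_path val_insubd; case: eqP => [<-|/eqP j0] /=; first by [].
case: ifPn => /=; first by rewrite inE j0 eqxx.
(* The one-edge path fails to fit only for N = 0, where the graph has no vertex besides [ord0]. *)
by case: N j j0 => // j; rewrite (ord1 j) eqxx.
Qed.

Let optimal_pathP (j : 'I_N.+1) : is_path ord0 j (optimal_path y ord0 j) /\
  forall q : seq 'I_N.+1, uniq (ord0 :: q) -> last ord0 q = j ->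
    fpp_dist y ord0 j <= path_weight y ord0 q.
Proof.
rewrite /fpp_dist /optimal_path; case: arg_minP => [|q jq qmin]; first exact: is_path_direct.
split => // q' uq' lq'.
have sq' : (size q' <= N)%N.
  by have := max_card (mem (ord0 :: q')); rewrite (card_uniqP uq') card_ord ltnS.
by apply: (qmin (Bseq sq')); rewrite /is_path uq' lq' eqxx.
Qed.

Let fpp_dist_i k : (k <= m)%N -> fpp_dist y ord0 (i k) = D k.
Proof.
move=> km; have [/andP[uq /eqP lq] qmin] := optimal_pathP (i k).
apply/eqP; rewrite eq_le; apply/andP; split.
  by have [q [uq' lq' <- _]] := tree_path km; exact: qmin.
by have := path_weight_ge uq; rewrite phi0 add0r lq phi_i.
Qed.

Let fpp_dist_out v : v \notin tree -> D m < fpp_dist y ord0 v.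
Proof.
move=> vt; have [/andP[uq /eqP lq] _] := optimal_pathP v.
rewrite /fpp_dist; move: (val _) uq lq => q.
case/lastP: q => [_ /= v0|q u].
  by rewrite -v0 -i0 in vt; move/treeP: vt; case; exists 0%N.
rewrite last_rcons => uq uv; rewrite uv in uq *.
have [|[k km [_ vE]]] := path_weight_last uq; first by rewrite phi_out.
by move/treeP: vt; case; exists k.+1.
Qed.

(** A path whose last edge is not the tree edge into [i k.+1] is strictly heavier than [D k.+1], the
    distance reached along the tree. *)
Let fpp_predecessor_i k : (k < m)%N -> fpp_predecessor y (i k.+1) = i (p k).
Proof.
move=> km; have [/andP[uq /eqP lq] _] := optimal_pathP (i k.+1).
have := fpp_dist_i km; rewrite /fpp_dist /fpp_predecessor.
move: (bseqval (optimal_path y ord0 (i k.+1))) uq lq => q.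
case/lastP: q => [_ /= v0|q u].
  by move: v0; rewrite -i0 => /i_inj; move=> /(_ isT km).
rewrite last_rcons => uq uv wq; rewrite uv in uq wq *.
have [|[l lm [lE kl]]] := path_weight_last uq.
  by rewrite phi_i// wq ltxx.
have {kl}[kl] := i_inj km lm kl.
rewrite size_rcons /= -rcons_cons nth_rcons /= ltnS leqnn.
by rewrite -[in nth _ _ _](last_nth) lE kl.
Qed.

Let others := [seq v <- enum 'I_N.+1 | v != ord0].
Let tail := [seq i k.+1 | k <- iota 0 m].
Let leD := (fun a b => fpp_dist y ord0 a <= fpp_dist y ord0 b).

(** Every outside distance exceeds [D m], so the sorted list begins with the tree vertices, and
    these are ordered by the increasing sequence [D]. *)
Let fpp_orderE : exists s, fpp_order y = ord0 :: tail ++ s.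
Proof.
have leD_total : total leD by move=> a b; exact: le_total.
have leD_trans : transitive leD by move=> a b c; exact: le_trans.
have tailP v : (v \in tail) = (v \in tree) && (v != ord0).
  apply/mapP/andP => [[k]|[/treeP[[|k] km ->]]].
  - rewrite mem_iota add0n => /= km ->; split; first by apply/treeP; exists k.+1.
    by rewrite -i0; apply/eqP => /i_inj; move=> /(_ km isT).
  - by rewrite i0 eqxx.
  - by move=> _; exists k; rewrite ?mem_iota.
have utail : uniq tail.
  rewrite map_inj_in_uniq ?iota_uniq// => k l; rewrite !mem_iota !add0n => /= km lm.
  by move=> /(i_inj km lm)[].
exists (seq.filter (predC (mem tree)) (sort leD others)).
rewrite /fpp_order -/others -/leD; congr (_ :: _).
rewrite [LHS](@sorted_filter_cat _ leD (mem tree))//; last 2 first.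
- exact: sort_sorted.
- move=> u v _ _ /= /treeP[k km ->] vt; rewrite /leD -ltNge fpp_dist_i//.
  by apply: le_lt_trans (D_le km (leqnn m)) (fpp_dist_out vt).
congr (_ ++ _); rewrite (filter_sort leD_total leD_trans).
have -> : sort leD [seq x <- others | mem tree x] = sort leD tail.
  apply/perm_sort_inP.
  - by move=> u v _ _; exact: leD_total.
  - by move=> u v w _ _ _; exact: leD_trans.
  - move=> u v; rewrite !mem_filter => /andP[/treeP[j jm ->] _] /andP[/treeP[k km ->] _].
    rewrite /leD !fpp_dist_i// !D_inj// => /andP[jk kj]; congr i.
    by apply/eqP; rewrite eqn_leq jk kj.
  - apply: uniq_perm => //; first by do 2!apply: filter_uniq; exact: enum_uniq.
    by move=> v; rewrite mem_filter /others mem_filter mem_enum andbT tailP.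
apply: sorted_sort => //.
rewrite sorted_map; apply: (sub_in_sorted (P := mem (iota 0 m)) (e := leq)).
- move=> j k /[!mem_iota] /[!add0n] /= jm km jk.
  by rewrite /leD !fpp_dist_i// D_inj.
- by apply/allP => k.
- exact: iota_sorted.
Qed.

Let nth_fpp_order k : (k <= m)%N -> nth ord0 (fpp_order y) k = i k.
Proof.
move=> km; have [s ->] := fpp_orderE; case: k km => [|k] km; first by rewrite i0.
rewrite /= nth_cat size_map size_iota km (nth_map 0%N) ?size_iota//.
by rewrite nth_iota.
Qed.

Lemma fpp_vertex_tree k : (k <= m)%N -> fpp_vertex y k = i k.
Proof. exact: nth_fpp_order. Qed.

Lemma fpp_parent_tree k : (k < m)%N -> fpp_parent y k.+1 = p k.
Proof.
move=> km; rewrite /fpp_parent fpp_vertex_tree// fpp_predecessor_i//.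
have pm := leq_trans (p_le km) (ltnW km).
rewrite -(nth_fpp_order pm) index_uniq//.
  have [s ->] := fpp_orderE; rewrite /= ltnS (leq_trans (p_le km))//.
  by rewrite size_cat size_map size_iota (leq_trans (ltnW km))// leq_addr.
rewrite /fpp_order /= sort_uniq filter_uniq ?enum_uniq// andbT.
by rewrite mem_sort mem_filter eqxx.
Qed.

End fpp_tree_of_weights.

(** The recursion reaches back to an arbitrary earlier index, so [D] is built by adding one value at
    a time. *)
Lemma tree_distances_ex (R : realType) (p : nat -> nat) (c : nat -> R) m :
  (forall k, (k < m)%N -> (p k <= k)%N) ->
  exists D : nat -> R, D 0%N = 0 /\ forall k, (k < m)%N -> D k.+1 = D (p k) + c k.
Proof.
elim: m => [|m IHm] p_le; first by exists (fun=> 0).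
have [|D [D0 DS]] := IHm; first by move=> k km; apply: p_le; exact: ltnW.
exists (fun k => if k == m.+1 then D (p m) + c m else D k); split => // k.
rewrite ltnS leq_eqVlt => /predU1P[->|km]; rewrite ?eqxx.
  by rewrite ltn_eqF// ltnS p_le.
rewrite eqSS (ltn_eqF km) ltn_eqF ?DS//.
by rewrite ltnS (leq_trans (p_le _ (ltnW km)))// ltnW.
Qed.

(** * Edge weights that force first passage percolation to follow the tree *)

Section fpp_invasion.
Context (R : realType) (N m : nat) (p a : nat -> nat) (i : nat -> 'I_N.+1)
  (h s : R) (K : nat).

(** The edge weight whose rescaled value is t, as [threshold_inv] confirms. *)
Definition threshold (t : R) : R := (t / N.+1%:R) `^ s.

Definition tree_edge k : {set 'I_N.+1} := [set i (p k); i k.+1]%SET.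

(* A sum over j rather than a maximum, so that the thresholds of all edges add
   up to at most N.+1 times the sum of the h (A_j + 2). *)
Definition avoided (e : {set 'I_N.+1}) : R :=
  \sum_(j < m) (if i j \in e then h * (depth m a j).+2%:R else 0).

Hypotheses (h0 : 0 < h) (s0 : 0 < s) (cpa : consistent m p a)
  (i_inj : forall j k, (j <= m)%N -> (k <= m)%N -> i j = i k -> j = k)
  (aK : forall k, (k < m)%N -> (a k <= K)%N)
  (K_large : forall b, (b <= K)%N -> m%:R * b.+1%:R `^ s <= b.+2%:R `^ s :> R).

Lemma tree_edge_inj k l : (k < m)%N -> (l < m)%N -> tree_edge k = tree_edge l -> k = l.
Proof.
clear h0 s0 aK K_large.
move=> km lm E; have [pk _] := cpa km; have [pl _] := cpa lm.
have : i k.+1 \in tree_edge l by rewrite -E !inE eqxx orbT.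
have : i l.+1 \in tree_edge k by rewrite E !inE eqxx orbT.
have pkm : (p k <= m)%N by apply: leq_trans pk (ltnW km).
have plm : (p l <= m)%N by apply: leq_trans pl (ltnW lm).
rewrite !inE => /orP[]/eqP E1 /orP[]/eqP E2;
  have := i_inj _ _ E1; have := i_inj _ _ E2; lia.
Qed.

Lemma threshold_ge0 t : 0 <= threshold t. Proof. exact: powR_ge0. Qed.

Lemma threshold_le t t' : 0 <= t -> t <= t' -> threshold t <= threshold t'.
Proof.
move=> t0 tt'; apply: ge0_ler_powR; rewrite ?nnegrE ?(ltW s0)// ?divr_ge0//.
  exact: le_trans tt'.
by rewrite ler_pM2r// invr_gt0.
Qed.

(** The effect of a large exponent: m edges up to the top of cell b weigh together no more than one
    edge at the top of the next cell. *)
Lemma threshold_mul b : (b <= K)%N ->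
  m%:R * threshold (h * b.+1%:R) <= threshold (h * b.+2%:R).
Proof.
move=> bK.
have E c : threshold (h * c%:R) = (h / N.+1%:R) `^ s * c%:R `^ s.
  by rewrite /threshold mulrAC [LHS]powRM// divr_ge0// ltW.
by rewrite !E mulrCA ler_wpM2l ?powR_ge0// K_large.
Qed.

Lemma depth_le j : (depth m a j <= K)%N.
Proof.
by apply/bigmax_leqP_seq => l; rewrite mem_index_iota => /andP[_ lm] _; exact: aK.
Qed.

Lemma avoided_ge0 e : 0 <= avoided e.
Proof. by apply: sumr_ge0 => j _; case: ifP => // _; rewrite mulr_ge0// ltW. Qed.

Lemma avoided_ge j (e : {set 'I_N.+1}) : (j < m)%N -> i j \in e ->
  h * (depth m a j).+2%:R <= avoided e.
Proof.
move=> jm je; rewrite /avoided (bigD1 (Ordinal jm))//= je lerDl.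
by apply: sumr_ge0 => l _; case: ifP => // _; rewrite mulr_ge0// ltW.
Qed.

Section weights.
Context (y : {set 'I_N.+1} -> R).
Hypotheses (i0 : i 0%N = ord0)
  (tree_y : forall k, (k < m)%N ->
    threshold (h * (a k)%:R) < y (tree_edge k) <= threshold (h * (a k).+1%:R))
  (other_y : forall e, is_edge e -> (forall k, (k < m)%N -> e <> tree_edge k) ->
    threshold (avoided e) < y e).

(** With [D] the distance along the tree, each hypothesis of the deterministic section says that one
    edge outweighs an increment of [D]. Such an increment is a sum of at most m edge weights in
    lower cells, and [threshold_mul] bounds it. *)
Lemma invasion_fpp : (forall k, (k <= m)%N -> fpp_vertex y k = i k) /\
  (forall k, (k < m)%N -> fpp_parent y k.+1 = p k).
Proof.
have p_le k : (k < m)%N -> (p k <= k)%N by move=> /cpa[].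
have y_gt0 u v : u != v -> 0 < y [set u; v]%SET.
  move=> uv; have euv : is_edge [set u; v]%SET by rewrite /is_edge cards2 uv.
  have [[k [km ->]]|nt] := pselect (exists k, (k < m)%N /\ [set u; v]%SET = tree_edge k).
    by have /andP[+ _] := tree_y km; apply: le_lt_trans; exact: threshold_ge0.
  apply: le_lt_trans (other_y euv _); first exact: threshold_ge0.
  by move=> k km E; apply: nt; exists k.
have [D [D0 DS]] := tree_distances_ex (fun k => y (tree_edge k)) p_le.
(* While [D] increases, [D (p l) <= D l], so each step of [D] is at most the weight of its tree
   edge, and the bounds add up. *)
have step B j k : (j <= k)%N -> (k <= m)%N -> 0 <= B ->
    (forall l, (l < k)%N -> D l < D l.+1) ->
    (forall l, (j <= l)%N -> (l < k)%N -> y (tree_edge l) <= B) ->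
    D k - D j <= m%:R * B.
  move=> jk km B0 Dlt yB; apply: (@le_trans _ _ ((k - j)%N%:R * B)); last first.
    by rewrite ler_wpM2r// ler_nat (leq_trans (leq_subr _ _)).
  elim: k jk km Dlt yB => [|k IHk].
    by rewrite leqn0 => /eqP -> *; rewrite subrr subnn mul0r.
  rewrite leq_eqVlt => /predU1P[->|]; first by move=> *; rewrite subrr subnn mul0r.
  rewrite ltnS => jk km Dlt yB; rewrite subSn// -natr1 mulrDl mul1r.
  have IH := IHk jk (ltnW km) (fun l lk => Dlt l (ltnW lk))
                 (fun l jl lk => yB l jl (ltnW lk)).
  have Dp : D (p k) <= D k.
    suff Dmono l : (p k <= l)%N -> (l <= k)%N -> D (p k) <= D l.
      exact: Dmono (p_le _ km) (leqnn k).
    elim: l => [|l IHl]; first by rewrite leqn0 => /eqP ->.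
    rewrite leq_eqVlt => /predU1P[->//|pl] lk.
    by apply: le_trans (IHl pl (ltnW lk)) (ltW (Dlt _ _)); rewrite ltnS ltnW.
  by rewrite DS//; have := yB k jk (ltnSn k); move: IH Dp; lra.
have D_lt k : (k < m)%N -> D k < D k.+1.
  elim/ltn_ind: k => k IHk km; rewrite DS//.
  have /andP[ylo _] := tree_y km.
  have Dlt l : (l < k)%N -> D l < D l.+1 by move=> lk; apply: IHk => //; exact: ltn_trans km.
  have [pk gap] := cpa km.
  have [pkk|pkk] := eqVneq (p k) k.
    by rewrite pkk ltrDl (le_lt_trans (threshold_ge0 _) ylo).
  have {}pkk : (p k < k)%N by rewrite ltn_neqAle pkk.
  have ak2 : (2 <= a k)%N by apply: leq_trans (gap _ (leqnn _) pkk).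
  (* Edges added since the arrival of the parent lie in cells at most [a k] - 2, whose tops are at
     most h ([a k] - 1); [threshold_mul] with b = [a k] - 2 then compares their sum with the bottom
     of cell [a k]. *)
  have stp : D k - D (p k) <= m%:R * threshold (h * (a k).-1%:R).
    apply: (step _ _ _ pk (ltnW km) (threshold_ge0 _) Dlt) => l pl lk.
    have /andP[_ yhi] := tree_y (ltn_trans lk km); apply: (le_trans yhi).
    apply: threshold_le; first by rewrite mulr_ge0// ltW.
    by rewrite ler_pM2l// ler_nat; have := gap l pl lk; lia.
  have := @threshold_mul (a k).-2; rewrite prednK; last by lia.
  rewrite (_ : (a k).-1.+1 = a k); last by lia.
  have -> : ((a k).-2 <= K)%N by have := aK km; lia.
  by move=> /(_ isT); move: stp ylo; lra.
(* A non-tree edge at [i j] exceeds the threshold of h (A_j + 2), where A_j is the depth, while the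
   tree edges added after vertex j have rescaled weight at most h (A_j + 1). *)
have far j k (e : {set 'I_N.+1}) : (j < m)%N -> (j <= k)%N -> (k <= m)%N ->
    is_edge e -> i j \in e -> (forall l, (l < m)%N -> e <> tree_edge l) -> D k < D j + y e.
  move=> jm jk km ee je nt; have ye := other_y ee nt.
  have stp : D k - D j <= m%:R * threshold (h * (depth m a j).+1%:R).
    apply: (step _ _ _ jk km (threshold_ge0 _)) => [l lk|l jl lk].
      exact: D_lt (leq_trans lk km).
    have /andP[_ yhi] := tree_y (leq_trans lk km); apply: (le_trans yhi).
    apply: threshold_le; first by rewrite mulr_ge0// ltW.
    by rewrite ler_pM2l// ler_nat ltnS leq_depth// (leq_trans lk).
  have := threshold_mul (depth_le j).
  have : threshold (h * (depth m a j).+2%:R) <= threshold (avoided e).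
    by apply: threshold_le; [rewrite mulr_ge0// ltW|exact: avoided_ge].
  by move: stp ye; lra.
have non_tree j k : (j <= k)%N -> (k < m)%N -> p k <> j ->
    D k.+1 < D j + y [set i j; i k.+1]%SET.
  move=> jk km pkj; have jm := leq_ltn_trans jk km.
  apply: far => //; first exact: leq_trans jk (leqnSn k).
  - rewrite /is_edge cards2; case: (i j =P i k.+1) => // /(i_inj (ltnW jm) km) E.
    by move: jk; rewrite E ltnn.
  - by rewrite !inE eqxx.
  - move=> l lm E; have pl := p_le _ lm.
    have : i k.+1 \in tree_edge l by rewrite -E !inE eqxx orbT.
    have : i l.+1 \in [set i j; i k.+1]%SET by rewrite E !inE eqxx orbT.
    have : i j \in tree_edge l by rewrite -E !inE eqxx.
    rewrite !inE => /orP[]/eqP E1 /orP[]/eqP E2 /orP[]/eqP E3;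
      have := i_inj _ _ E1; have := i_inj _ _ E2; have := i_inj _ _ E3; have := p_le _ lm;
      move: pkj; try lia.
    by move=> pkj _ E3' E2' E1'; apply: pkj; have <- : l = k by [lia]; lia.
have outside j v : (j <= m)%N -> (forall k, (k <= m)%N -> v <> i k) ->
    D m < D j + y [set i j; v]%SET.
  move=> jm vi; have ijv : i j != v by apply/eqP => E; exact: (vi j).
  move: jm; rewrite leq_eqVlt => /predU1P[jm|jm]; first by rewrite {1}jm ltrDl y_gt0.
  apply: far => //; [exact: ltnW|by rewrite /is_edge cards2 ijv|by rewrite !inE eqxx|].
  move=> l lm E; have : v \in tree_edge l by rewrite -E !inE eqxx orbT.
  rewrite !inE => /orP[]/eqP E1; last exact: (vi l.+1).
  by apply: (vi (p l)) => //; exact: leq_trans (p_le _ lm) (ltnW lm).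
split=> k km.
  exact: (fpp_vertex_tree y_gt0 i0 i_inj p_le D0 DS D_lt non_tree outside).
exact: (fpp_parent_tree y_gt0 i0 i_inj p_le D0 DS D_lt non_tree outside).
Qed.

Lemma threshold_inv t : 0 <= t -> N.+1%:R * threshold t `^ s^-1 = t.
Proof.
move=> t0; rewrite /threshold -powRrM mulfV ?gt_eqF// powRr1 ?divr_ge0//.
by rewrite mulrC divfK.
Qed.

Lemma invasion_fpp_box : box h p a (fpp_tree s y m).
Proof.
have [fv fp] := invasion_fpp; move=> k; rewrite mxE /=.
have km := ltn_ord k; rewrite fp//; split => //.
have [pk _] := cpa km.
rewrite /fpp_weight fp// !fv// ?(leq_trans pk (ltnW km))// -/(tree_edge k).
have /andP[lo hi] := tree_y km; rewrite /cell /= in_itv/=; apply/andP; split.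
  rewrite -[ltLHS]threshold_inv ?mulr_ge0 ?(ltW h0)// ltr_pM2l//.
  apply: gt0_ltr_powR; rewrite ?invr_gt0// ?nnegrE ?threshold_ge0//.
  exact: ltW (le_lt_trans (threshold_ge0 _) lo).
rewrite -[leRHS]threshold_inv ?mulr_ge0 ?(ltW h0)// ler_pM2l//.
apply: ge0_ler_powR; rewrite ?invr_ge0 ?(ltW s0)// ?nnegrE ?threshold_ge0//.
exact: ltW (le_lt_trans (threshold_ge0 _) lo).
Qed.

End weights.
End fpp_invasion.

(** * Probability of a box for first passage percolation *)

(** The density vanishes on negative numbers, where the real power is only a convention; preimages
    under the power can thus be computed on [[0, +oo[]. *)
Lemma exponential_prob_nonneg (R : realType) (V : set R) :
  exponential_prob 1 V = exponential_prob 1 (V `&` `[0, +oo[).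
Proof.
rewrite /exponential_prob integral_mkcondr; apply: eq_integral => x _.
rewrite patchE; case: ifPn => //; rewrite notin_setE /= in_itv/= andbT => /negP.
by rewrite -ltNge => x0; rewrite lt0_exponential_pdf.
Qed.

Section exp_power_law.
Context d (T : measurableType d) (R : realType) (P : probability T R)
  (s : R) (Y : {RV P >-> R}).
Hypotheses (s0 : 0 < s) (lawY : has_exp_power_law s Y).

Lemma exp_power_le u : 0 <= u ->
  P (Y @^-1` `]-oo, u `^ s]) = (1 - expR (- u))%:E.
Proof.
move=> u0; have := lawY (measurable_itv `]-oo, u `^ s]).
rewrite /distribution /pushforward => ->; rewrite exponential_prob_nonneg.
have -> : (fun x => x `^ s) @^-1` `]-oo, u `^ s] `&` `[0, +oo[ = `[0, u]%classic.
  apply/seteqP; split => x /=; rewrite !in_itv/= ?andbT.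
    move=> [xu x0]; rewrite x0 /= leNgt; apply/negP => ux.
    by move: xu; rewrite leNgt gt0_ltr_powR// nnegrE.
  move=> /andP[x0 xu]; split => //.
  by apply: ge0_ler_powR; rewrite ?nnegrE// ltW.
move: u0; rewrite le_eqVlt => /predU1P[<-|u0]; last first.
  by rewrite exponential_prob_itv0c// mulN1r EFinB.
by rewrite oppr0 expR0 subrr set_itv1 /exponential_prob integral_set1.
Qed.

Lemma exp_power_gt u : 0 <= u ->
  P (Y @^-1` `]u `^ s, +oo[) = (expR (- u))%:E.
Proof.
move=> u0; have -> : Y @^-1` `]u `^ s, +oo[ = ~` (Y @^-1` `]-oo, u `^ s]).
  by rewrite preimage_setC setCitvl.
rewrite probability_setC; last first.
  by rewrite -[X in measurable X]setTI; apply: measurable_funP.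
by rewrite exp_power_le// -EFinB opprB addrCA subrr addr0.
Qed.

Lemma exp_power_between u v : 0 <= u -> u <= v ->
  P (Y @^-1` `]u `^ s, v `^ s]) = (expR (- u) - expR (- v))%:E.
Proof.
move=> u0 uv; have v0 := le_trans u0 uv.
have usvs : u `^ s <= v `^ s by apply: ge0_ler_powR; rewrite ?nnegrE// ltW.
have mY (A : interval R) : measurable (Y @^-1` [set` A]).
  by rewrite -[X in measurable X]setTI; apply: measurable_funP.
have -> : Y @^-1` `]u `^ s, v `^ s] =
    (Y @^-1` `]u `^ s, +oo[) `\` (Y @^-1` `]v `^ s, +oo[).
  apply/seteqP; split => w /=; rewrite !in_itv/= ?andbT.
    by move=> /andP[-> ?]; split => //; apply/negP; rewrite -leNgt.
  by move=> [-> /negP]; rewrite -leNgt.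
rewrite measureD; [|exact: mY|exact: mY|]; last first.
  exact: le_lt_trans (probability_le1 P (mY _)) (ltry _).
rewrite setIidr; last first.
  by move=> w /=; rewrite !in_itv/= !andbT; exact: le_lt_trans.
by rewrite EFinB -(exp_power_gt u0) -(exp_power_gt v0).
Qed.

End exp_power_law.

Lemma measure_bigcup_seq d (T : measurableType d) (R : realType)
    (P : probability T R) (I : choiceType) (r : seq I) (F : I -> set T) :
  uniq r -> (forall i, i \in r -> measurable (F i)) -> trivIset [set` r] F ->
  P (\bigcup_(i in [set` r]) F i) = (\sum_(i <- r) P (F i))%E.
Proof.
move=> ur mF tF; rewrite measure_fin_bigcup//.
by rewrite -fsbig_seq.
Qed.

(** The vertices i_0, ..., i_m with i_0 = [ord0]. Since [lift ord0] avoids the root, their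
    distinctness is injectivity of f, and the choices are counted by the falling factorial
    [N ^_ m]. *)
Definition labelling m N (f : {ffun 'I_m -> 'I_N}) (k : nat) : 'I_N.+1 :=
  if k is k'.+1 then oapp (fun j => lift ord0 (f j)) ord0 (insub k') else ord0.

Lemma labellingE m N (f : {ffun 'I_m -> 'I_N}) (k : 'I_m) :
  labelling f k.+1 = lift ord0 (f k).
Proof. by rewrite /labelling valK. Qed.

Lemma labelling_inj m N (f : {ffun 'I_m -> 'I_N}) : injective f ->
  forall j k, (j <= m)%N -> (k <= m)%N -> labelling f j = labelling f k -> j = k.
Proof.
move=> f_inj [|j] [|k] // jm km.
- by rewrite -[k]/(val (Ordinal km)) labellingE => /eqP; rewrite (negbTE (neq_lift _ _)).
- by rewrite -[j]/(val (Ordinal jm)) labellingE => /esym/eqP; rewrite (negbTE (neq_lift _ _)).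
rewrite -[j]/(val (Ordinal jm)) -[k]/(val (Ordinal km)) !labellingE.
by move=> /lift_inj /f_inj ->.
Qed.

Section fpp_box_probability.
Context d (T : measurableType d) (R : realType) (P : probability T R) (N m : nat)
  (Y : {set 'I_N.+1} -> {RV P >-> R}) (s h : R) (p a : nat -> nat) (K : nat).
Hypotheses (Y_law : forall e, is_edge e -> has_exp_power_law s (Y e))
  (Y_indep : mutually_independent P [set e | is_edge e]
    (fun e => generated_by (fun _ : unit => Y e : T -> R)))
  (h0 : 0 < h) (h1 : h <= 1) (s0 : 0 < s) (cpa : consistent m p a)
  (aK : forall k, (k < m)%N -> (a k <= K)%N)
  (K_large : forall b, (b <= K)%N -> m%:R * b.+1%:R `^ s <= b.+2%:R `^ s :> R).

Let tree w : 'rV[(nat * R)%type]_m := fpp_tree s (fun e => Y e w) m.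
Local Notation n := (N.+1%:R : R).

(** For an edge that meets none of i_0, ..., i_(m-1), [avoided] is 0 and the condition is just
    positivity of the weight. *)
Definition target (i : nat -> 'I_N.+1) (e : {set 'I_N.+1}) : interval R :=
  if [pick k : 'I_m | e == tree_edge p i k] is Some k then
    `]threshold N s (h * (a k)%:R), threshold N s (h * (a k).+1%:R)]
  else `]threshold N s (avoided m a i h e), +oo[.

Definition invasion_event (i : nat -> 'I_N.+1) : set T :=
  \bigcap_(e in [set` enum (@is_edge N)]) (Y e @^-1` [set` target i e]).

Lemma measurable_invasion_event i : measurable (invasion_event i).
Proof.
rewrite /invasion_event bigcap_seq; apply: bigsetI_measurable => e _.
by rewrite -[X in measurable X]setTI; apply: measurable_funP.
Qed.

Section labelled.
Context (i : nat -> 'I_N.+1).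
Hypotheses (i0 : i 0%N = ord0)
  (i_inj : forall j k, (j <= m)%N -> (k <= m)%N -> i j = i k -> j = k).

Lemma tree_edge_is_edge k : (k < m)%N -> is_edge (tree_edge p i k).
Proof.
move=> km; have [pk _] := cpa km; rewrite /is_edge cards2.
case: (i (p k) =P i k.+1) => // /i_inj E.
by have := E (leq_trans pk (ltnW km)) km; move: pk => /[swap] ->; rewrite ltnn.
Qed.

Lemma invasion_event_weights w : invasion_event i w ->
  (forall k, (k < m)%N ->
    threshold N s (h * (a k)%:R) < Y (tree_edge p i k) w <=
    threshold N s (h * (a k).+1%:R)) /\
  (forall e, is_edge e -> (forall k, (k < m)%N -> e <> tree_edge p i k) ->
    threshold N s (avoided m a i h e) < Y e w).
Proof.
move=> iw; split => [k km|e ee nt].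
  have := iw (tree_edge p i k); rewrite /= mem_enum => /(_ (tree_edge_is_edge km)).
  rewrite /target; case: pickP => [l /eqP E|/(_ (Ordinal km))]; last by rewrite eqxx.
  have -> : k = l by exact: (tree_edge_inj cpa i_inj km (ltn_ord l) E).
  by rewrite /= in_itv.
have := iw e; rewrite /= mem_enum => /(_ ee); rewrite /target.
case: pickP => [l /eqP E|_]; first by have := nt l (ltn_ord l).
by rewrite /= in_itv/= andbT.
Qed.

Lemma invasion_event_box w : invasion_event i w ->
  box h p a (tree w) /\ forall k, (k <= m)%N -> fpp_vertex (fun e => Y e w) k = i k.
Proof.
move=> /invasion_event_weights[tw ow]; split.
  exact: (invasion_fpp_box h0 s0 cpa i_inj aK K_large i0 tw ow).
by have [] := invasion_fpp h0 s0 cpa i_inj aK K_large i0 tw ow.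
Qed.

Let is_tree e : bool := [exists k : 'I_m, e == tree_edge p i k].

(** For a tree edge with cell ends u < v after division by n, e^-u - e^-v = e^-v (e^(h/n) - 1) >=
    (h/n) e^-v, and v <= avoided/n because the edge contains its parent vertex. Charging tree edges
    for [avoided] too gives one formula for all edges. *)
Lemma probability_target e : is_edge e ->
  (((h / n) ^+ is_tree e * expR (- (avoided m a i h e / n)))%:E <=
   P (Y e @^-1` [set` target i e]))%E.
Proof.
move=> ee; have n0 : 0 < n by rewrite ltr0n.
have div_ge0 t : 0 <= t -> 0 <= t / n by move=> t0; rewrite divr_ge0// ltW.
rewrite /target; case: pickP => [k /eqP eE|nt]; last first.
  rewrite (_ : is_tree e = false); last by apply/existsP => -[k]; rewrite nt.
  rewrite expr0 mul1r /threshold exp_power_gt//; first exact: Y_law.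
  by apply: div_ge0; exact: avoided_ge0.
have -> : is_tree e by apply/existsP; exists k; rewrite eE.
have km := ltn_ord k; have [pk _] := cpa km.
have ge0 b : 0 <= h * b%:R by rewrite mulr_ge0// ltW.
rewrite /threshold exp_power_between ?div_ge0 ?ge0//; [|exact: Y_law|]; last first.
  by rewrite ler_pM2r ?invr_gt0// ler_pM2l// ler_nat.
rewrite lee_fin expr1.
have le_av : h * (a k).+1%:R <= avoided m a i h e.
  apply: le_trans (avoided_ge a h0 (leq_ltn_trans pk km) _); last by rewrite eE !inE eqxx.
  by rewrite ler_pM2l// ler_nat ltnS ltnW// ltnS leq_depth.
apply: (@le_trans _ _ (h / n * expR (- (h * (a k).+1%:R / n)))).
  rewrite ler_wpM2l ?div_ge0 ?(ltW h0)// ler_expR lerN2.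
  by rewrite ler_pM2r// invr_gt0.
have -> : - (h * (a k)%:R / n) = - (h * (a k).+1%:R / n) + h / n.
  by rewrite -natr1; field; rewrite gt_eqF.
rewrite expRD [X in _ <= X - _]mulrC -[X in _ - X]mul1r -mulrBl ler_wpM2r ?expR_ge0//.
by rewrite lerBrDl expR_ge1Dx.
Qed.

Lemma sum_is_tree_le : (\sum_(e <- enum (@is_edge N)) is_tree e <= m)%N.
Proof.
have -> : (\sum_(e <- enum (@is_edge N)) is_tree e =
    \sum_(e <- enum (@is_edge N) | is_tree e) 1)%N.
  by rewrite [RHS]big_mkcond; apply: eq_bigr => e _; case: is_tree.
rewrite -big_filter sum1_size.
apply: (@leq_trans #|[set tree_edge p i k | k : 'I_m]|).
  rewrite -(card_uniqP (filter_uniq _ (enum_uniq _))).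
  apply: subset_leq_card; apply/fintype.subsetP => e.
  by rewrite mem_filter => /andP[/existsP[k /eqP ->] _]; exact: imset_f.
by apply: (leq_trans (leq_imset_card _ _)); rewrite card_ord.
Qed.

(** Exchange the sums: each [i j] lies on at most n edges. This factor n cancels the 1/n in the
    exponents. *)
Lemma sum_avoided_le : \sum_(e <- enum (@is_edge N)) avoided m a i h e <=
  n * \sum_(j < m) h * (depth m a j).+2%:R.
Proof.
rewrite exchange_big mulr_sumr; apply: ler_sum => j _ /=.
rewrite -big_mkcond /= -big_filter big_const_seq count_predT iter_addr_0.
rewrite -[leLHS]mulr_natl ler_wpM2r//; first by rewrite mulr_ge0// ltW.
rewrite ler_nat -(card_uniqP (filter_uniq _ (enum_uniq _))).
apply: (@leq_trans #|[set [set i j; u]%SET | u : 'I_N.+1]|).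
  apply: subset_leq_card; apply/fintype.subsetP => e.
  rewrite mem_filter mem_enum => /andP[je /cards2P[u [v [uv eE]]]].
  move: je; rewrite eE !inE => /orP[]/eqP ->.
    by apply/imsetP; exists v.
  by apply/imsetP; exists u => //; rewrite finset.setUC.
by apply: (leq_trans (leq_imset_card _ _)); rewrite card_ord.
Qed.

Lemma probability_invasion_event :
  (((h / n) ^+ m * expR (- \sum_(j < m) h * (depth m a j).+2%:R))%:E <=
   P (invasion_event i))%E.
Proof.
have n0 : 0 < n by rewrite ltr0n.
have mtarget e : measurable (Y e @^-1` [set` target i e]).
  by rewrite -[X in measurable X]setTI; apply: measurable_funP.
rewrite /invasion_event (Y_indep (A := fun e => Y e @^-1` [set` target i e]))//; last 2 first.
- exact: enum_uniq.
- move=> e; rewrite mem_enum => ee; split => //.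
  apply: sub_gen_smallest; exists tt => //; exists [set` target i e].
    exact: measurable_itv.
  by rewrite setTI.
apply: (@le_trans _ _ (\prod_(e <- enum (@is_edge N))
    ((h / n) ^+ is_tree e * expR (- (avoided m a i h e / n))))%:E); last first.
  under [leRHS]eq_bigr => e _ do rewrite -(fineK (fin_num_measure P _ (mtarget e))).
  rewrite prodEFin lee_fin !big_seq; apply: ler_prod => e; rewrite mem_enum => ee.
  rewrite mulr_ge0 ?exprn_ge0 ?expR_ge0 ?divr_ge0 ?(ltW h0) ?(ltW n0)//=.
  by rewrite -lee_fin fineK ?fin_num_measure//; exact: probability_target.
rewrite lee_fin big_split /= -expr_sum -(big_morph (@expR R) (@expRD R) (@expR0 R)).
apply: ler_pM; rewrite ?exprn_ge0 ?expR_ge0 ?divr_ge0 ?(ltW h0) ?(ltW n0)//.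
  (* Since h/n <= 1, an upper bound m on the number of tree edges gives a lower bound on the
     power. *)
  apply: ler_wiXn2l; rewrite ?sum_is_tree_le ?divr_ge0 ?(ltW h0) ?(ltW n0)//.
  by rewrite ler_pdivrMr// mul1r (le_trans h1)// ler1n.
rewrite ler_expR sumrN lerN2 -mulr_suml ler_pdivrMr// mulrC.
exact: sum_avoided_le.
Qed.

End labelled.

(** Each invasion event determines the first vertices reached, hence the labelling, so the events of
    distinct injections are disjoint and their probabilities add up. *)
Lemma probability_fpp_box_ge :
  (((h / n) ^+ m * expR (- \sum_(j < m) h * (depth m a j).+2%:R) *+ (N ^_ m))%:E <=
   P (tree @^-1` box h p a))%E.
Proof.
pose D : {set {ffun 'I_m -> 'I_N}} :=
  finset (fun f : {ffun 'I_m -> 'I_N} => injectiveb f).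
have fD f : f \in enum D -> injective f by rewrite mem_enum inE => /injectiveP.
apply: (@le_trans _ _ (P (\bigcup_(f in [set` enum D]) invasion_event (labelling f)))).
  rewrite measure_bigcup_seq ?enum_uniq//; last 2 first.
  - by move=> f _; exact: measurable_invasion_event.
  - move=> f g /= /fD fi /fD gi [w [wf wg]]; apply/ffunP => k.
    have [_ wf'] := invasion_event_box erefl (labelling_inj fi) wf.
    have [_ wg'] := invasion_event_box erefl (labelling_inj gi) wg.
    by apply: (@lift_inj _ ord0); rewrite -!labellingE -wf'// -wg'.
  have -> : (N ^_ m = size (enum D))%N by rewrite -cardE card_inj_ffuns !card_ord.
  rewrite -sum1_size -sumrMnr -sumEFin big_seq [leRHS]big_seq.
  apply: lee_sum => f /fD fi; rewrite mulr1n.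
  by apply: probability_invasion_event => //; exact: labelling_inj fi.
apply: le_measure.
- apply: mem_set; apply: fin_bigcup_measurable => // f _.
  exact: measurable_invasion_event.
- by apply: mem_set; apply: measurable_box; apply: borel_fun_fpp_tree.
- move=> w [f /= /fD fi wf].
  by have [] := invasion_event_box erefl (labelling_inj fi) wf.
Qed.

End fpp_box_probability.

(** * Approximation of open sets by boxes *)

Definition extend m n (f : {ffun 'I_m -> 'I_n}) (k : nat) : nat :=
  oapp (fun j => val (f j)) 0%N (insub k).

Lemma extendE m n (f : {ffun 'I_m -> 'I_n}) (k : 'I_m) : extend f k = f k.
Proof. by rewrite /extend valK. Qed.

Section grid.
Context (R : realType) (m : nat) (U : set 'rV[(nat * R)%type]_m).

Definition mesh (r : nat) : R := r.+1%:R^-1.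

(** Parents are below m, and (r+1)^2 cells of length 1/(r+1) cover (0, r+1], so finitely many boxes
    suffice while both the mesh and the range improve with r. *)
Definition grid_index r : finType :=
  ({ffun 'I_m -> 'I_m} * {ffun 'I_m -> 'I_(r.+1 ^ 2)})%type.

Definition grid_box r (c : grid_index r) : set 'rV[(nat * R)%type]_m :=
  box (mesh r) (extend c.1) (extend c.2).

Definition grid_inside r (c : grid_index r) : bool :=
  `[< gapped m (extend c.2) /\ grid_box c `<=` U >].

Definition grid r : set 'rV[(nat * R)%type]_m :=
  \bigcup_(c in [set` enum (@grid_inside r)]) grid_box c.

Lemma mesh_gt0 r : 0 < mesh r.
Proof. by rewrite invr_gt0 ltr0n. Qed.

Lemma mesh_le1 r : mesh r <= 1.
Proof. by rewrite invf_le1 ?ler1n// ltr0n. Qed.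

Lemma grid_sub r : grid r `<=` U.
Proof. by move=> x [c /=]; rewrite mem_enum => /asboolP[_]; apply. Qed.

Lemma grid_box_inj r (c c' : grid_index r) x :
  grid_box c x -> grid_box c' x -> c = c'.
Proof.
case: c c' => [p a] [p' a'] xc xc'; congr (_, _); apply/ffunP => k; apply/val_inj.
  have [+ _] := xc k; have [+ _] := xc' k; rewrite /= !extendE.
  by move=> -> <-.
have [_ /= xa] := xc k; have [_ /= xa'] := xc' k; rewrite !extendE in xa xa'.
exact: cell_inj (mesh_gt0 r) xa xa'.
Qed.

Lemma probability_grid d (T : measurableType d) (P : probability T R)
    (Z : T -> 'rV[(nat * R)%type]_m) r : borel_fun Z ->
  P (Z @^-1` grid r) =
  (\sum_(c <- enum (@grid_inside r)) P (Z @^-1` grid_box c))%E.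
Proof.
move=> mZ; rewrite /grid preimage_bigcup measure_bigcup_seq ?enum_uniq//.
  by move=> c _; exact: measurable_box.
by move=> c c' _ _ [w [/= cw c'w]]; exact: grid_box_inj cw c'w.
Qed.

Lemma measurable_grid d (T : measurableType d)
    (Z : T -> 'rV[(nat * R)%type]_m) r : borel_fun Z ->
  measurable (Z @^-1` grid r).
Proof.
move=> mZ; rewrite /grid preimage_bigcup.
by apply: fin_bigcup_measurable => // c _; exact: measurable_box.
Qed.

Lemma cell_dist (h r t : R) b : 0 < h -> cell h b r -> cell h b t -> `|r - t| < h.
Proof.
move=> h0; rewrite /cell /= !in_itv/= -natr1 mulrDr mulr1.
move=> /andP[r1 r2] /andP[t1 t2].
by rewrite ltr_distlC; apply/andP; split; lra.
Qed.

(** The box of x lies in U once the mesh is below the radius e, and its cells are non-adjacent once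
    twice the mesh is below all distances between the weights of x. *)
Lemma near_grid x : open U -> U x ->
  (forall k, ((x ord0 k).1 < m)%N /\ 0 < (x ord0 k).2) ->
  (forall k l, k != l -> (x ord0 k).2 <> (x ord0 l).2) ->
  \forall r \near \oo, grid r x.
Proof.
move=> oU Ux xpos xdis; have [e e0 eU] := open_rV_box oU Ux.
have meshe (t : R) : 0 < t -> \forall r \near \oo, mesh r < t.
  by move=> t0; exact: (near_infty_natSinv_lt (PosNum t0)).
have near1 : \forall r \near \oo, mesh r < e by exact: meshe.
have near2 : \forall r \near \oo, forall k l : 'I_m, k != l ->
    mesh r < `|(x ord0 k).2 - (x ord0 l).2| / 2.
  apply: filter_forall => k; apply: filter_forall => l.
  have [->|kl] := eqVneq k l; first by near=> r.
  near=> r => _; near: r; apply: meshe; rewrite divr_gt0// normr_gt0 subr_eq0.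
  by apply/eqP; exact: xdis.
have near3 : \forall r \near \oo, forall k : 'I_m, (x ord0 k).2 <= r%:R.
  by apply: filter_forall => k; exact: nbhs_infty_ger.
apply: filterS3 near1 near2 near3 => r near1 near2 near3.
have h0 := mesh_gt0 r.
have cellP k : exists b : 'I_(r.+1 ^ 2), cell (mesh r) b (x ord0 k).2.
  have [b xb] := cell_ex h0 (xpos k).2.
  suff br : (b < r.+1 ^ 2)%N by exists (Ordinal br).
  move: (xb); rewrite /cell /= in_itv/= => /andP[bx _].
  have : mesh r * b%:R < r.+1%:R.
    by apply: lt_le_trans bx (le_trans (near3 k) _); rewrite ler_nat.
  by rewrite /mesh mulrC ltr_pdivrMr// -natrM ltr_nat mulnn.
pose c : grid_index r := ([ffun k => Ordinal (xpos k).1],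
                          [ffun k => sval (cid (cellP k))]).
have xc : grid_box c x.
  move=> k; rewrite /= !extendE !ffunE /=; split => //.
  exact: svalP (cid (cellP k)).
exists c => //=; rewrite mem_enum; apply/asboolP; split.
  move=> k l km lm kl.
  have [_ /= xk] := xc (Ordinal km); have [_ /= xl] := xc (Ordinal lm).
  have : mesh r < `|(x ord0 (Ordinal km)).2 - (x ord0 (Ordinal lm)).2| / 2.
    by apply: near2; apply/eqP => -[].
  move: xk xl; set u := extend _ k; set v := extend _ l.
  have [uv _|uv] := leqP u.+2 v; first by left.
  have [vu _|vu] := leqP v.+2 u; first by right.
  rewrite /cell /= !in_itv/= => /andP[k1 k2] /andP[l1 l2].
  (* Equal or adjacent cells would put the two weights within twice the mesh of each other. *)
  have uv' : mesh r * u.+1%:R <= mesh r * v%:R + 2 * mesh r.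
    rewrite -[X in _ + X]mulrC -mulrDr ler_pM2l// -natrD ler_nat; lia.
  have vu' : mesh r * v.+1%:R <= mesh r * u%:R + 2 * mesh r.
    rewrite -[X in _ + X]mulrC -mulrDr ler_pM2l// -natrD ler_nat; lia.
  rewrite ltr_pdivlMr// mulrC ltNge => /negP; case.
  by rewrite ler_distlC; apply/andP; split; lra.
move=> y yc; apply: eU => k.
have [x1 x2] := xc k; have [y1 y2] := yc k; split; first by rewrite y1 x1.
exact: lt_trans (cell_dist h0 x2 y2) near1.
Unshelve. all: by end_near. Qed.

End grid.

(** Monotonicity of the grids in r is replaced by that of H r, the intersection of all grids from r
    on. By [near_grid] their union almost surely contains the event, and continuity from below
    applies. The lower bound r0 leaves the mesh as small as desired. *)
Lemma grid_approx d (T : measurableType d) (R : realType) (P : probability T R)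
    (X : vertex -> {RV P >-> R}) m (U : set 'rV[(nat * R)%type]_m) (e : R) r0 :
  is_PWIT X -> open U -> 0 < e ->
  let tree w := ip_tree (fun v => X v w) m in
  exists2 r, (r0 <= r)%N & (P (tree @^-1` U) <= P (tree @^-1` grid U r) + e%:E)%E.
Proof.
move=> pwX oU e0 tree.
have mtree : borel_fun tree by exact: borel_fun_ip_tree.
pose H r : set T := \bigcap_(q in [set q | (r <= q)%N]) (tree @^-1` grid U q).
have mH r : measurable (H r).
  by apply: bigcap_measurableType => q _; exact: measurable_grid.
have mHU : measurable (\bigcup_r H r) by exact: bigcupT_measurable.
have cvgH : P (H r) @[r --> \oo] --> P (\bigcup_r H r).
  apply: nondecreasing_cvg_mu => // r q rq; apply/subsetPset => w wH j /= qj.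
  by apply: wH; exact: leq_trans rq qj.
have UH : (P (tree @^-1` U) <= P (\bigcup_r H r))%E.
  apply: probability_le_ae => //; first exact: mtree.
  apply: filterS (pwit_generic pwX) => w gw wU.
  have [k|k l kl|r _ rP] := @near_grid R m U (tree w) oU wU.
  - rewrite mxE /=; have [pos _ _] := gw.
    split; first exact: leq_ltn_trans (ip_parent_le gw k) (ltn_ord k).
    by have [c ->] := ip_vertex_child gw k; exact: pos.
  - rewrite !mxE /=; have [_ _ dis] := gw.
    have [c cE] := ip_vertex_child gw k; have [c' cE'] := ip_vertex_child gw l.
    rewrite cE cE'; apply: dis; rewrite -cE -cE' => E.
    have kl' : k != l :> nat by [].
    have := uniq_IP gw m; have km := ltn_ord k; have lm := ltn_ord l.
    move=> /(uniqP [::])/(_ k.+1 l.+1); rewrite !inE !size_IP !ltnS => /(_ km lm).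
    by rewrite !nth_IP// E => /(_ erefl)[] /eqP; rewrite (negbTE kl').
  - by exists r => // q /= rq; exact: rP.
have [r [r0r rP]] : exists r, (r0 <= r)%N /\ (P (\bigcup_r H r) <= P (H r) + e%:E)%E.
  have xE : P (\bigcup_r H r) = (fine (P (\bigcup_r H r)))%:E.
    by rewrite fineK// fin_num_measure.
  move: cvgH; rewrite xE => /fine_cvg/cvgrPdist_lt/(_ e e0)[r1 _ r1P].
  exists (maxn r0 r1); split; first exact: leq_maxl.
  have := r1P (maxn r0 r1) (leq_maxr _ _).
  rewrite -[P (H _)]fineK ?fin_num_measure// -EFinD lee_fin /=.
  by rewrite ltr_distl => /andP[_ /ltW].
exists r => //; apply: (le_trans UH); apply: (le_trans rP).
rewrite leeD2r//; apply: le_measure; [exact: mem_set|apply: mem_set|].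
  exact: measurable_grid.
by move=> w /(_ r (leqnn r)).
Qed.

(** * Comparison of the two laws on a box, and conclusion *)

Lemma ffact_ratio_cvg (R : realType) m :
  (N ^_ m)%:R / N.+1%:R ^+ m @[N --> \oo] --> (1 : R).
Proof.
elim: m => [|m IHm].
  by under eq_fun do rewrite ffactn0 expr0 divr1; exact: cvg_cst.
(* The next factor of the ratio is (N - m)/(N + 1) = 1 - (m + 1)/(N + 1). *)
have H : (N ^_ m)%:R / N.+1%:R ^+ m * (1 - m.+1%:R * N.+1%:R^-1) @[N --> \oo]
    --> (1 * (1 - m.+1%:R * 0) : R).
  apply: cvgM => //; apply: cvgB; first exact: cvg_cst.
  by apply: cvgM; [exact: cvg_cst|exact: cvg_harmonic].
rewrite mulr0 subr0 mulr1 in H; apply: cvg_trans H; apply: near_eq_cvg.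
exists m => // N /= mN; rewrite ffactnSr natrM exprSr natrB//.
have N0 : N.+1%:R != 0 :> R by rewrite pnatr_eq0.
rewrite invfM mulrACA; congr (_ * _).
by rewrite mulrBl mulrC -natr1 -[in m.+1%:R]natr1; field; rewrite natr1.
Qed.

(** As e^x >= 1 + x, it is enough that s_n (ln(b+2) - ln(b+1)) >= m, which holds eventually for the
    finitely many b at once. *)
Lemma powR_gap (R : realType) (s : nat -> R) m K : s n @[n --> \oo] --> +oo ->
  \forall n \near \oo, forall b, (b <= K)%N ->
    m%:R * b.+1%:R `^ s n <= b.+2%:R `^ s n :> R.
Proof.
move=> s_cvg.
have H : \forall n \near \oo, forall b : 'I_K.+1,
    m%:R / (ln b.+2%:R - ln b.+1%:R) <= s n.
  by apply: filter_forall => b; move/cvgryPge : s_cvg; apply.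
apply: filterS H => n H b bK; have := H (Ordinal (bK : (b < K.+1)%N)); rewrite /=.
have dpos : 0 < ln b.+2%:R - ln b.+1%:R :> R.
  by rewrite subr_gt0 ltr_ln ?posrE ?ltr0n// ltr_nat.
rewrite ler_pdivrMr// /powR !pnatr_eq0/= => ms.
apply: (@le_trans _ _ (expR (s n * (ln b.+2%:R - ln b.+1%:R)) * expR (s n * ln b.+1%:R))).
  rewrite ler_wpM2r ?expR_ge0//; apply: le_trans ms _.
  by apply: le_trans (expR_ge1Dx _); rewrite lerDr.
by rewrite -expRD mulrBr subrK.
Qed.

(** Inconsistent boxes have no mass under invasion percolation. For the others, the exponent 3 m h
    collects m h from the factor (e^h)^m of the upper bound and 2 m h from the terms A_j + 2 of the
    lower bound. *)
Lemma probability_box_compare (R : realType) d (T : measurableType d)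
    (P : probability T R) N m (Y : {set 'I_N.+1} -> {RV P >-> R}) (s h : R)
    (p a : nat -> nat) K d' (T' : measurableType d') (P' : probability T' R)
    (X : vertex -> {RV P' >-> R}) :
  (forall e, is_edge e -> has_exp_power_law s (Y e)) ->
  mutually_independent P [set e | is_edge e]
    (fun e => generated_by (fun _ : unit => Y e : T -> R)) ->
  is_PWIT X -> 0 < h -> h <= 1 -> 0 < s ->
  gapped m a -> (forall k, (k < m)%N -> (a k <= K)%N) ->
  (forall b, (b <= K)%N -> m%:R * b.+1%:R `^ s <= b.+2%:R `^ s :> R) ->
  ((expR (- (3 * m%:R * h)) * ((N ^_ m)%:R / N.+1%:R ^+ m))%:E *
     P' ((fun w => ip_tree (fun v => X v w) m) @^-1` box h p a) <=
   P ((fun w => fpp_tree s (fun e => Y e w) m) @^-1` box h p a))%E.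
Proof.
move=> Y_law Y_indep pwX h0 h1 s0 ga aK K_large.
have [cpa|ncpa] := pselect (consistent m p a); last first.
  by rewrite (probability_ip_box_inconsistent pwX h0 ga ncpa) mule0.
set S := (\sum_(j < m) depth m a j)%N.
have c0 : 0 <= expR (- (3 * m%:R * h)) * ((N ^_ m)%:R / N.+1%:R ^+ m) :> R.
  by rewrite mulr_ge0 ?expR_ge0// divr_ge0// exprn_ge0.
apply: le_trans (probability_fpp_box_ge Y_law Y_indep h0 h1 s0 cpa aK K_large).
apply: (le_trans (lee_wpmul2l _ (probability_ip_box_le pwX h0 ga cpa))).
  by rewrite lee_fin.
rewrite -EFinM lee_fin -/S.
have -> : \sum_(j < m) h * (depth m a j).+2%:R = h * S%:R + 2 * m%:R * h.
  rewrite /S natr_sum mulr_sumr.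
  have E j : h * (depth m a j).+2%:R = h * (depth m a j)%:R + 2 * h.
    by rewrite -addn2 natrD; ring.
  under eq_bigr => j _ do rewrite E.
  by rewrite big_split /= sumr_const card_ord -[_ *+ m]mulr_natl; congr (_ + _); ring.
have -> : (h * expR h) ^+ m = h ^+ m * expR (m%:R * h).
  by rewrite exprMn expRM_natl.
have -> : expR (- (h * S%:R + 2 * m%:R * h)) =
    expR (- (3 * m%:R * h)) * expR (m%:R * h) * expR (- h * S%:R).
  by rewrite -!expRD; congr expR; ring.
rewrite -mulr_natr expr_div_n le_eqVlt; apply/orP; left; apply/eqP.
by field; rewrite expf_neq0// pnatr_eq0.
Qed.

Unset Implicit Arguments.

(* Index N stands for n = N + 1, the number of vertices of the graph. *)
Theorem theorem1p2 (R : realType) (s : nat -> R)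
  (s_gt0 : forall n : nat, (0 < n)%N -> 0 < s n)
  (s_cvg : s n @[n --> \oo] --> +oo)
  (d : nat -> measure_display) (T : forall N, measurableType (d N))
  (P : forall N, probability (T N) R)
  (Y : forall N, {set 'I_N.+1} -> {RV (P N) >-> R})
  (Y_law : forall N (e : {set 'I_N.+1}), is_edge e ->
    has_exp_power_law (s N.+1) (Y N e))
  (Y_indep : forall N, mutually_independent (P N) [set e | is_edge e]
    (fun e => generated_by (fun _ : unit => Y N e : T N -> R)))
  (d' : measure_display) (T' : measurableType d') (P' : probability T' R)
  (X : vertex -> {RV P' >-> R}) (X_PWIT : is_PWIT X)
  (m : nat) :
  cvg_in_distribution P
    (fun N (w : T N) => fpp_tree (s N.+1) (fun e => Y N e w) m)
    P' (fun w : T' => ip_tree (fun v => X v w) m).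
Proof.
apply: portmanteau_open => [N||U e oU e0].
- exact: borel_fun_fpp_tree.
- exact: borel_fun_ip_tree.
have mip : borel_fun (fun w : T' => ip_tree (fun v => X v w) m).
  exact: borel_fun_ip_tree.
(* One t pays for the grid approximation, and the factor (1 - t)^2 loses at most 2 t; the sum is at
   most e. *)
pose t : R := Num.min (e / 3) 1.
have t0 : 0 < t by rewrite lt_min divr_gt0//= ltr01.
have t1 : t <= 1 by rewrite ge_min lexx orbT.
have te : 3 * t <= e by rewrite mulrC -ler_pdivlMr// ge_min lexx.
have q0 : 0 < t / (3 * m%:R + 1) by rewrite divr_gt0// ltr_wpDl// mulr_ge0.
have /= [r0 _ r0P] := near_infty_natSinv_lt (PosNum q0).
have [r r0r rP] := grid_approx (m := m) r0 X_PWIT oU t0.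
have mesh_small : 3 * m%:R * mesh R r <= t.
  have := r0P r r0r; rewrite /= -/(mesh R r) => /ltW.
  rewrite ler_pdivlMr ?ltr_wpDl ?mulr_ge0// mulrDr mulr1 mulrC.
  by have := mesh_gt0 R r; lra.
have sS : s N.+1 @[N --> \oo] --> +oo by rewrite cvg_shiftS.
(* The grid is fixed before N grows, so its cells have a bound independent of N. *)
have gap := @powR_gap R (fun N => s N.+1) m (r.+1 ^ 2)%N sS.
have /cvgrPdist_le/(_ t t0) ratio := @ffact_ratio_cvg R m.
apply: filterS2 gap ratio => N gap ratio.
set Xn := fun w : T N => fpp_tree (s N.+1) (fun e => Y N e w) m.
set X' := fun w : T' => ip_tree (fun v => X v w) m.
have mfpp : borel_fun Xn by exact: borel_fun_fpp_tree.
pose c : R := expR (- (3 * m%:R * mesh R r)) * ((N ^_ m)%:R / N.+1%:R ^+ m).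
(* One factor comes from exp(-x) >= 1 - x with x = 3 m h <= t, where h is the mesh, the other from
   the falling factorial ratio, which is within t of 1. *)
have le_c : (1 - t) * (1 - t) <= c.
  apply: ler_pM; rewrite ?subr_ge0//.
    apply: le_trans (expR_ge1Dx _); lra.
  by move: ratio; rewrite ler_distlC => /andP[].
have grid_le : (c%:E * P' (X' @^-1` grid U r) <= P N (Xn @^-1` grid U r))%E.
  rewrite !probability_grid// ge0_sume_distrr//.
  rewrite !big_seq; apply: lee_sum => -[p a]; rewrite mem_enum => /asboolP[ga _].
  have aK k : (k < m)%N -> (extend a k <= r.+1 ^ 2)%N.
    by move=> km; rewrite -[k]/(val (Ordinal km)) extendE ltnW.
  exact: (probability_box_compare (extend p) (Y_law N) (Y_indep N) X_PWIT
    (mesh_gt0 R r) (mesh_le1 R r) (s_gt0 N.+1 (ltn0Sn N)) ga aK gap).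
have grid_U : (P N (Xn @^-1` grid U r) <= P N (Xn @^-1` U))%E.
  apply: le_measure; [apply: mem_set|apply: mem_set|].
  - exact: measurable_grid.
  - exact: mfpp.
  - by move=> w; exact: grid_sub.
have Pf dd (S : measurableType dd) (Q : probability S R) A : measurable A ->
    Q A = (fine (Q A))%:E by move=> mA; rewrite fineK// fin_num_measure.
have mU' := mip _ oU; have mUn := mfpp _ oU.
have mG := @measurable_grid _ _ U _ _ X' r mip.
have := le_trans grid_le grid_U; move: rP; rewrite -/X'.
have x0 : (0 <= P' (X' @^-1` grid U r))%E by [].
have x1 : (P' (X' @^-1` grid U r) <= 1)%E by exact: probability_le1.
move: x0 x1; rewrite (Pf _ _ _ _ mG) (Pf _ _ _ _ mU') (Pf _ _ _ _ mUn).
rewrite -EFinM -!EFinD !lee_fin; set x := fine _; set u := fine _; set v := fine _.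
move=> x0 x1 ux cxv; have : (1 - t) * (1 - t) * x <= c * x by rewrite ler_wpM2r.
nra.
Qed.
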